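(* Let $m,n$ be positive integers and let $\mathbf{A}$ be an $m\times n$ random subgaussian matrix, i.e. either a random Gaussian matrix or a random Rademacher matrix. Let $\mathbf{W}\in\mathbb{R}^{n\times n}$ be a (possibly random) symmetric matrix with all eigenvalues in $[0,1]$ that is statistically independent of $\mathbf{A}$, and let $r=\operatorname{rank}(\mathbf{W})$. Let $\boldsymbol{\xi}\in\mathbb{R}^n$, $\boldsymbol{\eta}\in\mathbb{R}^m$ and $\delta\geqslant 0$ be fixed, and let $\boldsymbol{b}=\mathbf{A}\boldsymbol{\xi}+\boldsymbol{\eta}$. Consider the optimization problem $$(\mathrm{P}_\delta)\qquad \text{minimize } \ \boldsymbol{x}^\top(\mathbf{I}-\mathbf{W})\mathbf{W}^\dagger\boldsymbol{x}\quad\text{subject to}\quad \|\mathbf{A}\boldsymbol{x}-\boldsymbol{b}\|^2\leqslant\delta^2,\ \ \boldsymbol{x}\in\mathcal{R}(\mathbf{W}),$$ and let $\Omega_\delta$ denote its feasible set. For $\epsilon,\beta\in(0,1)$, suppose $$m\geqslant\frac{\ln(4/\beta)+r\ln(12/\epsilon)}{\gamma(\epsilon/2)},$$ where $\gamma(t)=t^2/6$ if $\mathbf{A}$ is Gaussian and $\gamma(t)=t^2/4-t^3/6$ if $\mathbf{A}$ is Rademacher. Then with probability at least $1-\beta$ the following holds: if $\Omega_\delta\neq\emptyset$ and $\boldsymbol{x}^\ast$ is a minimizer of $(\mathrm{P}_\delta)$, then $$\|\boldsymbol{x}^\ast-\boldsymbol{\xi}\|\leqslant\left(1+\frac{2}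{1-\epsilon}\right)\operatorname{dist}\big(\boldsymbol{\xi},\mathcal{R}(\mathbf{W})\big)+\frac{\delta+\|\boldsymbol{\eta}\|}{1-\epsilon}.$$
   Context: $\|\cdot\|$ is the Euclidean norm and $\operatorname{dist}(\boldsymbol{\xi},\mathcal{R}(\mathbf{W}))$ is the Euclidean distance from $\boldsymbol{\xi}$ to the range $\mathcal{R}(\mathbf{W})$ of $\mathbf{W}$. A random Gaussian matrix is an $m\times n$ matrix whose entries are i.i.d. Gaussian with mean $0$ and variance $1/m$. A random Rademacher matrix is an $m\times n$ matrix whose entries are i.i.d., each equal to $1/\sqrt{m}$ or $-1/\sqrt{m}$ with probability $1/2$ each. $\mathbf{W}^\dagger$ is the Moore–Penrose pseudoinverse and $\mathbf{I}$ is the $n\times n$ identity. The matrix $\mathbf{W}$ may be deterministic; if it is random, the stated conditions on $\mathbf{W}$ (and on its rank) are assumed to hold almost surely. *)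

(* Defs.v *)
From mathcomp Require Import all_boot all_order all_algebra.
From mathcomp Require Import all_classical all_reals all_analysis.

Set Implicit Arguments.
Unset Strict Implicit.
Unset Printing Implicit Defensive.

Import Order.TTheory GRing.Theory Num.Theory.

Local Open Scope classical_set_scope.
Local Open Scope ring_scope.

(* The library norm `|x| on matrices is the sup norm, hence this definition. *)
Definition enorm {R : realType} {k : nat} (x : 'cV[R]_k) : R :=
  Num.sqrt (\sum_i x i 0 ^+ 2).

Definition mxrange {R : realType} {p k : nat} (W : 'M[R]_(p, k)) :
    set 'cV[R]_p :=
  range (fun z : 'cV[R]_k => W *m z).

Definition dist_to {R : realType} {k : nat} (x : 'cV[R]_k) (S : set 'cV[R]_k) : R :=
  inf [set enorm (x - y) | y in S].

Definition penrose {R : realType} {p k : nat} (W : 'M[R]_(p, k))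
    (X : 'M[R]_(k, p)) : Prop :=
  [/\ W *m X *m W = W, X *m W *m X = X,
      (W *m X)^T = W *m X & (X *m W)^T = X *m W].

(* The default value 0 is never used: see pinvP and pinv_unique below. *)
Definition pinv {R : realType} {p k : nat} (W : 'M[R]_(p, k)) : 'M[R]_(k, p) :=
  xget 0 [set X | penrose W X].

Lemma gram_unit {R : realType} {p k : nat} (F : 'M[R]_(p, k)) :
  row_free F -> F *m F^T \in unitmx.
Proof.
move=> fF; rewrite -row_free_unit -kermx_eq0.
apply/rowV0P => u /sub_kermxP uFF.
suff : u *m F = 0 by move=> uF; apply: (row_free_inj fF); rewrite uF mul0mx.
have : (u *m F) *m (u *m F)^T = 0.
  by rewrite trmx_mul mulmxA -(mulmxA u) uFF mul0mx.
move: (u *m F) => v vv.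
have : \sum_j v 0 j ^+ 2 = 0.
  move/matrixP/(_ 0 0): vv; rewrite !mxE => vv.
  by rewrite -[RHS]vv; apply: eq_bigr => j _; rewrite !mxE expr2.
move/eqP; rewrite psumr_eq0; last by move=> j _; exact: sqr_ge0.
move/allP => v0; apply/rowP => j; rewrite mxE.
by have := v0 j (mem_index_enum _); rewrite /= sqrf_eq0 => /eqP.
Qed.

Lemma penrose_factor {R : realType} {p r k : nat} (C : 'M[R]_(p, r))
    (F : 'M[R]_(r, k)) :
  row_free F -> row_free C^T -> exists X, penrose (C *m F) X.
Proof.
move=> fF fC.
have uF : F *m F^T \in unitmx by exact: gram_unit.
have uC : C^T *m C \in unitmx by rewrite -{2}[C]trmxK; exact: gram_unit.
pose G := invmx (F *m F^T); pose H := invmx (C^T *m C).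
have tG : G^T = G by rewrite trmx_inv trmx_mul trmxK.
have tH : H^T = H by rewrite trmx_inv trmx_mul trmxK.
pose X := F^T *m G *m H *m C^T.
have WX : C *m F *m X = C *m H *m C^T.
  rewrite /X -!mulmxA; congr (C *m _).
  by rewrite (mulmxA F) (mulmxA _ G) mulmxV// mul1mx.
have XW : X *m (C *m F) = F^T *m G *m F.
  by rewrite /X -!mulmxA (mulmxA C^T) (mulmxA H) mulVmx// mul1mx.
exists X; split.
- by rewrite WX -!mulmxA (mulmxA C^T) (mulmxA H) mulVmx// mul1mx.
- rewrite XW /X -!mulmxA; congr (F^T *m _).
  by rewrite (mulmxA F) (mulmxA G) mulVmx// mul1mx.
- by rewrite WX !trmx_mul trmxK tH mulmxA.
- by rewrite XW !trmx_mul trmxK tG mulmxA.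
Qed.

Lemma penrose_ex {R : realType} {p k : nat} (W : 'M[R]_(p, k)) :
  exists X, penrose W X.
Proof.
have [|X] := penrose_factor (row_base_free W) (C := col_base W).
  by rewrite /row_free mxrank_tr; have := col_base_full W; rewrite /row_full.
by rewrite mulmx_base => h; exists X.
Qed.

Lemma pinvP {R : realType} {p k : nat} (W : 'M[R]_(p, k)) : penrose W (pinv W).
Proof. by rewrite /pinv; case: xgetP => [X _ //|] h; have [X /h] := penrose_ex W. Qed.

Lemma penrose_unique {R : realType} {p k : nat} (W : 'M[R]_(p, k)) X Y :
  penrose W X -> penrose W Y -> X = Y.
Proof.
move=> [X1 X2 X3 X4] [Y1 Y2 Y3 Y4].
have e1 : W *m X = W *m Y.
  rewrite -X3 -[in LHS]Y1 -mulmxA [LHS]trmx_mul X3 Y3.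
  by rewrite mulmxA X1.
have e2 : X *m W = Y *m W.
  have -> : Y *m W = (Y *m W) *m (X *m W) by rewrite -mulmxA (mulmxA W) X1.
  by rewrite -[RHS]trmxK [in RHS]trmx_mul X4 Y4 -mulmxA (mulmxA W) Y1 X4.
by rewrite -X2 e2 -mulmxA e1 mulmxA.
Qed.

Lemma pinv_unique {R : realType} {p k : nat} (W : 'M[R]_(p, k)) X :
  penrose W X -> pinv W = X.
Proof. by move=> /(penrose_unique (pinvP W)). Qed.

Definition mutually_independent {d : measure_display} {T : measurableType d}
    {R : realType} (P : probability T R) (I : finType) (X : I -> {RV P >-> R}) :
    Prop :=
  forall (J : {set I}) (B : I -> set R), (forall i, measurable (B i)) ->
    (P (\bigcap_(i in [set` J]) (X i @^-1` B i)) =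
     \prod_(i in J) P (X i @^-1` B i))%E.

(* A random matrix is a matrix of random variables. *)
Definition rmx_at {d : measure_display} {T : measurableType d} {R : realType}
    {P : probability T R} {p k : nat} (A : 'M[{RV P >-> R}]_(p, k)) (w : T) :
    'M[R]_(p, k) :=
  \matrix_(i, j) (A i j : T -> R) w.

Definition rmx_sigma {d : measure_display} {T : measurableType d} {R : realType}
    {P : probability T R} {p k : nat} (A : 'M[{RV P >-> R}]_(p, k)) :
    set (set T) :=
  <<s [set E | exists i j, preimage_set_system setT (A i j) measurable E] >>.

Definition independent_rmx {d : measure_display} {T : measurableType d}
    {R : realType} (P : probability T R) {p k p' k' : nat}
    (A : 'M[{RV P >-> R}]_(p, k)) (W : 'M[{RV P >-> R}]_(p', k')) : Prop :=
  forall E F, rmx_sigma A E -> rmx_sigma W F -> (P (E `&` F) = P E * P F)%E.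

Variant ensemble := Gaussian | Rademacher.

(* normal_prob takes the standard deviation, not the variance. *)
Definition entry_law {d : measure_display} {T : measurableType d} {R : realType}
    {P : probability T R} (e : ensemble) (m : nat) (X : {RV P >-> R}) : Prop :=
  let s : R := (Num.sqrt m%:R)^-1 in
  match e with
  | Gaussian => forall B : set R, measurable B ->
      distribution P X B = normal_prob 0 s B
  | Rademacher => P (X @^-1` [set s]) = (2^-1)%:E /\
                  P (X @^-1` [set - s]) = (2^-1)%:E
  end.

Definition random_subgaussian {d : measure_display} {T : measurableType d}
    {R : realType} {P : probability T R} (e : ensemble) {m n : nat}
    (A : 'M[{RV P >-> R}]_(m, n)) : Prop :=
  mutually_independent (fun ij : 'I_m * 'I_n => A ij.1 ij.2) /\
  forall i j, entry_law e m (A i j).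

Definition gamma_rate {R : realType} (e : ensemble) (t : R) : R :=
  match e with
  | Gaussian => t ^+ 2 / 6
  | Rademacher => t ^+ 2 / 4 - t ^+ 3 / 6
  end.

Definition objective {R : realType} {n : nat} (W : 'M[R]_n) (x : 'cV[R]_n) : R :=
  (x^T *m (1%:M - W) *m pinv W *m x) 0 0.

Definition feasible {R : realType} {m n : nat} (A : 'M[R]_(m, n)) (W : 'M[R]_n)
    (b : 'cV[R]_m) (delta : R) : set 'cV[R]_n :=
  [set x | enorm (A *m x - b) ^+ 2 <= delta ^+ 2 /\ mxrange W x].

Definition minimizer {R : realType} {m n : nat} (A : 'M[R]_(m, n)) (W : 'M[R]_n)
    (b : 'cV[R]_m) (delta : R) (x : 'cV[R]_n) : Prop :=
  feasible A W b delta x /\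
  forall y, feasible A W b delta y -> objective W x <= objective W y.

(* Main.v *)
(** The bound holds for every feasible point as soon as [A] satisfies a one-sided
    isometry on the range of [W] and does not expand [xi - v] by more than a factor
    [2], where [v] is the projection of [xi] on that range.  By independence and
    Fubini it suffices to treat a fixed [W], and then both properties follow if [A]
    preserves the squared norm, up to [eps / 2], of the unit vectors of an
    [eps / 3]-net of the sphere of the range and of the normalization of [xi - v];
    this is a union bound.

    The two ensembles are treated together: for a unit vector [x] each entry [Y]
    of [sqrt m * A x] satisfies [1 + s^2/2 <= E exp(s Y) <= exp(s^2/2)].  The upper
    bound, averaged over a Gaussian [s], bounds [E exp(l Y^2)], and both bounds as
    [s] tends to [0] give [E Y^2 >= 1] and [E Y^4 <= 3], whence a bound on
    [E exp(- l Y^2)]; Chernoff's method then yields deviation probabilities at most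
    [exp(- m (t^2/4 - t^3/6)) <= exp(- m t^2/6)] for [t <= 1/2].
    The net is a grid, counted by means of a generating function instead of volumes. *)
Require Import Defs.
From mathcomp Require Import all_boot all_order all_algebra.
From mathcomp Require Import all_classical all_reals all_analysis.
From mathcomp Require Import measurable_realfun ring lra.

Set Implicit Arguments.
Unset Strict Implicit.
Unset Printing Implicit Defensive.

Import Order.TTheory GRing.Theory Num.Theory.
Import numFieldNormedType.Exports.

Local Open Scope classical_set_scope.
Local Open Scope ring_scope.

(** * Independence of generated sigma-algebras *)

(** The constants of the bound come from one point [v] of the range: for feasible [x],
    [A *m (x - v)] has norm at most [delta + enorm eta + 2 * D], where [D] is the distance from [xi]
    to the range. The lower isometry, applied to [x - v], divides this by [1 - epsilon], and a last
    [D] leads from [v] back to [xi]. Outside the range [A] is thus tested on a single vector, the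
    residual.

    The obstacle is the randomness of [W]. Fubini needs the good event to be measurable jointly in
    the two matrices, whereas the projection and the net are chosen separately for each [W], with no
    measurability. The event therefore sees [W] only through its products with countably many
    rational vectors; projection and net enter after [W] has been frozen, where they serve only to
    bound a probability. *)

Section independence.
Context {d : measure_display} {T : measurableType d} {R : realType}.
Variable P : probability T R.

Definition indep_sys (G1 G2 : set (set T)) : Prop :=
  forall E F, G1 E -> G2 F -> (P (E `&` F) = P E * P F)%E.

Lemma g_sigma_sub_measurable (G : set (set T)) :
  G `<=` measurable -> <<s G >> `<=` measurable.
Proof. by apply: smallest_sub; exact: sigma_algebra_measurable. Qed.

Lemma indep_sys_sym (G1 G2 : set (set T)) : indep_sys G1 G2 -> indep_sys G2 G1.
Proof. by move=> h E F E1 F1; rewrite setIC muleC; exact: h. Qed.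

(** For fixed [E], both [P (E & F)] and [P E * P F] are finite measures in [F]; they agree on the
    pi-system [G2], hence on the sigma-algebra it generates. *)
Lemma indep_sys_sigmar (G1 G2 : set (set T)) :
  G1 `<=` measurable -> G2 `<=` measurable -> G2 setT -> setI_closed G2 ->
  indep_sys G1 G2 -> indep_sys G1 <<s G2 >>.
Proof.
move=> mG1 mG2 G2T IG2 ind E F G1E.
have mE : measurable E by exact: mG1.
have PE0 : (0 <= fine (P E))%R by exact/fine_ge0/measure_ge0.
pose m1 : {measure set T -> \bar R} := mrestr P mE.
pose m2 : {measure set T -> \bar R} := mscale (NngNum PE0) P.
have m2E H : m2 H = (P E * P H)%E.
  by rewrite /m2/= /mscale/= fineK// fin_num_measure.
rewrite -m2E setIC -[LHS]/(m1 F).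
apply: (@g_sigma_algebra_measure_unique _ _ _ G2 mG2 (fun=> setT)) => //.
- by rewrite bigcup_const//; exists 0%N.
- by move=> A G2A; rewrite m2E /m1/= /mrestr setIC; exact: ind.
- move=> _; rewrite /= /mrestr setTI.
  by rewrite (le_lt_trans (probability_le1 P mE))// ltry.
Qed.

Lemma indep_sys_sigma (G1 G2 : set (set T)) :
  G1 `<=` measurable -> G1 setT -> setI_closed G1 ->
  G2 `<=` measurable -> G2 setT -> setI_closed G2 ->
  indep_sys G1 G2 -> indep_sys <<s G1 >> <<s G2 >>.
Proof.
move=> mG1 G1T IG1 mG2 G2T IG2 ind.
apply/indep_sys_sym/indep_sys_sigmar => //; first exact: g_sigma_sub_measurable.
exact/indep_sys_sym/indep_sys_sigmar.
Qed.

(** The identity of [T], viewed as a random element of [T] equipped with the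
    sigma-algebra generated by [G]: Fubini for two independent sigma-algebras is
    then Fubini for the joint law of [sub_id G1] and [sub_id G2]. *)
Definition sub_id (G : set (set T)) : T -> g_sigma_algebraType G := id.

Lemma measurable_sub_id (G : set (set T)) : G `<=` measurable ->
  measurable_fun setT (sub_id G).
Proof. by move=> mG _ B mB; rewrite setTI; exact: (g_sigma_sub_measurable mG mB). Qed.

Definition sub_prob (G : set (set T)) (mG : G `<=` measurable) :
    probability (g_sigma_algebraType G) R :=
  distribution P (mfun_Sub (mem_set (measurable_sub_id mG))).

Lemma integral_sub_prob (G : set (set T)) (mG : G `<=` measurable)
    (f : g_sigma_algebraType G -> \bar R) :
  measurable_fun setT f -> (forall x, 0 <= f x)%E ->
  (\int[sub_prob mG]_x f x = \int[P]_x f (sub_id G x))%E.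
Proof. by move=> mf f0; rewrite ge0_integral_distribution. Qed.

Lemma indep_fubini (G1 G2 : set (set T)) :
  G1 `<=` measurable -> G2 `<=` measurable ->
  indep_sys <<s G1 >> <<s G2 >> ->
  forall f : g_sigma_algebraType G1 * g_sigma_algebraType G2 -> \bar R,
  measurable_fun setT f -> (forall z, 0 <= f z)%E ->
  (\int[P]_w f (sub_id G1 w, sub_id G2 w) =
   \int[P]_w2 \int[P]_w1 f (sub_id G1 w1, sub_id G2 w2))%E.
Proof.
move=> mG1 mG2 ind f mf f0.
pose D (w : T) := (sub_id G1 w, sub_id G2 w).
have mD : measurable_fun setT D.
  by apply/measurable_fun_pairP; split; exact: measurable_sub_id.
pose mu : probability _ R := distribution P (mfun_Sub (mem_set mD)).
transitivity (\int[mu]_z f z)%E; first by rewrite ge0_integral_distribution.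
(* Independence says that the joint law and the product measure agree on rectangles, which determine
   the product measure. *)
transitivity (\int[sub_prob mG1 \x sub_prob mG2]_z f z)%E.
  apply: eq_measure_integral => A mA _; apply/esym.
  apply: product_measure_unique => // E F mE mF; exact: ind.
rewrite fubini_tonelli2// integral_sub_prob//; last first.
- by move=> x; exact: integral_ge0.
- exact: measurable_fun_fubini_tonelli_G.
apply: eq_integral => w _; rewrite /fubini_G integral_sub_prob//.
exact: measurableT_comp.
Qed.

Lemma measurable_integral_section (G1 G2 : set (set T)) :
  G1 `<=` measurable -> G2 `<=` measurable ->
  forall f : g_sigma_algebraType G1 * g_sigma_algebraType G2 -> \bar R,
  measurable_fun setT f -> (forall z, 0 <= f z)%E ->
  measurable_fun setT
    (fun w2 => \int[P]_w1 f (sub_id G1 w1, sub_id G2 w2))%E.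
Proof.
move=> mG1 mG2 f mf f0.
have -> : (fun w2 => \int[P]_w1 f (sub_id G1 w1, sub_id G2 w2))%E =
    (fubini_G (sub_prob mG1) f) \o (sub_id G2).
  apply/funext => w2; rewrite /fubini_G /comp integral_sub_prob//.
  exact: measurableT_comp.
apply: measurableT_comp; last exact: measurable_sub_id.
exact: measurable_fun_fubini_tonelli_G.
Qed.

Lemma indep_integralM (G1 G2 : set (set T)) :
  G1 `<=` measurable -> G2 `<=` measurable ->
  indep_sys <<s G1 >> <<s G2 >> ->
  forall (U : g_sigma_algebraType G1 -> \bar R)
    (V : g_sigma_algebraType G2 -> \bar R),
  measurable_fun setT U -> (forall z, 0 <= U z)%E ->
  measurable_fun setT V -> (forall z, 0 <= V z)%E ->
  (\int[P]_w (U w * V w) = \int[P]_w U w * \int[P]_w V w)%E.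
Proof.
move=> mG1 mG2 ind U V mU U0 mV V0.
pose f (z : g_sigma_algebraType G1 * g_sigma_algebraType G2) :=
  (U z.1 * V z.2)%E.
have mf : measurable_fun setT f.
  by apply: emeasurable_funM; exact: measurableT_comp.
have f0 z : (0 <= f z)%E by exact: mule_ge0.
transitivity (\int[P]_w2 \int[P]_w1 f (sub_id G1 w1, sub_id G2 w2))%E.
  exact: (indep_fubini mG1 mG2 ind mf f0).
rewrite /f/=.
have mU' : measurable_fun setT (U : T -> \bar R).
  exact: (measurableT_comp mU (measurable_sub_id mG1)).
have mV' : measurable_fun setT (V : T -> \bar R).
  exact: (measurableT_comp mV (measurable_sub_id mG2)).
under eq_integral => w _.
  rewrite (@ge0_integralZr _ _ _ P setT measurableT (U : T -> \bar R))//=.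
  over.
rewrite ge0_integralZl//.
exact: integral_ge0.
Qed.

End independence.

(** * Functions of disjoint blocks of independent variables *)

Section blocks.
Context {d : measure_display} {T : measurableType d} {R : realType}.
Variables (P : probability T R) (I : finType) (X : I -> {RV P >-> R}).

(** A pi-system generating the sigma-algebra of the block of the [X i] with [i] in [J]. All indices
    of [J] are constrained at once, which makes it closed under intersection. *)
Definition rv_cylinders (J : {set I}) : set (set T) :=
  [set E | exists2 B : I -> set R, (forall i, measurable (B i)) &
     E = \bigcap_(i in [set` J]) (X i @^-1` B i)].

Lemma rv_cylinders_measurable J : rv_cylinders J `<=` measurable.
Proof.
move=> _ [B mB ->]; apply: fin_bigcap_measurable => // i _.
by rewrite -[_ @^-1` _]setTI; exact: measurable_funP.
Qed.

Lemma rv_cylindersT J : rv_cylinders J setT.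
Proof. by exists (fun=> setT) => //; rewrite bigcapT. Qed.

Lemma rv_cylindersI J : setI_closed (rv_cylinders J).
Proof.
move=> _ _ [B mB ->] [C mC ->]; exists (fun i => B i `&` C i).
  by move=> i; exact: measurableI.
apply/seteqP; split=> [w [Bw Cw] i iJ|w h]; first by split; [exact: Bw|exact: Cw].
by split=> i iJ; have [] := h i iJ.
Qed.

Lemma rv_cylindersS (J1 J2 : {set I}) : J1 \subset J2 ->
  rv_cylinders J1 `<=` rv_cylinders J2.
Proof.
move=> J12 _ [B mB ->].
exists (fun i => if i \in J1 then B i else setT); first by move=> i; case: ifP.
apply/seteqP; split=> [w h i /= iJ2|w h i /= iJ1].
  by case: ifPn => // iJ1; exact: h.
by have := h i (fintype.subsetP J12 _ iJ1); rewrite iJ1.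
Qed.

(** It suffices to treat cylinders. Two cylinders over disjoint index sets glue to one over the
    union, and mutual independence applies to each of the three. *)
Lemma rv_cylinders_indep (J1 J2 : {set I}) :
  mutually_independent X -> disjoint (mem J1) (mem J2) ->
  indep_sys P <<s rv_cylinders J1 >> <<s rv_cylinders J2 >>.
Proof.
move=> indX dJ; apply: indep_sys_sigma;
  [exact: rv_cylinders_measurable|exact: rv_cylindersT|exact: rv_cylindersI|
   exact: rv_cylinders_measurable|exact: rv_cylindersT|exact: rv_cylindersI|].
move=> _ _ [B mB ->] [C mC ->].
pose D i := if i \in J1 then B i else C i.
have mD i : measurable (D i) by rewrite /D; case: ifP.
have DJ1 : \bigcap_(i in [set` J1]) (X i @^-1` B i) =
    \bigcap_(i in [set` J1]) (X i @^-1` D i).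
  by apply: eq_bigcapr => i /= iJ; rewrite /D iJ.
have DJ2 : \bigcap_(i in [set` J2]) (X i @^-1` C i) =
    \bigcap_(i in [set` J2]) (X i @^-1` D i).
  by apply: eq_bigcapr => i /= iJ; rewrite /D (disjointFl dJ iJ).
rewrite DJ1 DJ2 !indX// -bigcap_setU.
have -> : [set` J1] `|` [set` J2] = [set` J1 :|: J2].
  by apply/seteqP; split=> i /=; rewrite inE => /orP.
rewrite indX// big_mkcond/= [in RHS]big_mkcond/= [X in (_ = _ * X)%E]big_mkcond/=.
rewrite -big_split/=; apply: eq_bigr => i _; rewrite inE.
case: (boolP (i \in J1)) => /= iJ1; first by rewrite (disjointFr dJ iJ1) mule1.
by rewrite mul1e.
Qed.

Lemma g_sigma_measurable_funS d' (S : sigmaRingType d') (G G' : set (set T))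
    (f : T -> S) : G `<=` G' ->
  measurable_fun setT (f : g_sigma_algebraType G -> S) ->
  measurable_fun setT (f : g_sigma_algebraType G' -> S).
Proof.
move=> GG' mf mT B mB; have := mf measurableT B mB.
exact: sub_sigma_algebra2.
Qed.

Lemma measurable_rv_cylinders (J : {set I}) i : i \in J ->
  measurable_fun setT (X i : g_sigma_algebraType (rv_cylinders J) -> R).
Proof.
move=> iJ _ B mB; apply: sub_sigma_algebra.
exists (fun j => if j == i then B else setT); first by move=> j; case: ifP.
rewrite setTI; apply/seteqP; split=> [w Bw j /= jJ|w /(_ i iJ)]/=.
  by case: ifP => // /eqP ->.
by rewrite eqxx.
Qed.

(** One factor is split off at a time: the remaining product is measurable for the union of the
    remaining blocks. It is used with single entries as blocks, within a row, and with whole rows as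
    blocks. *)
Lemma integral_prod_indep (K : eqType) (s : seq K) (J : K -> {set I})
    (U : K -> T -> \bar R) :
  mutually_independent X -> uniq s ->
  {in s &, forall k l, k != l -> disjoint (mem (J k)) (mem (J l))} ->
  (forall k, measurable_fun setT
     (U k : g_sigma_algebraType (rv_cylinders (J k)) -> \bar R)) ->
  (forall k w, 0 <= U k w)%E ->
  (\int[P]_w (\prod_(k <- s) U k w) = \prod_(k <- s) \int[P]_w U k w)%E.
Proof.
move=> indX us dJ mU U0; elim: s us dJ => [_ _|k s ih /= /andP[ks us] dJ].
  under eq_integral do rewrite big_nil.
  by rewrite big_nil integral_cst// mul1e; exact: probability_setT.
under eq_integral do rewrite big_cons.
rewrite big_cons -ih//; last first.
  by move=> a b als bs; apply: dJ; rewrite inE ?als ?bs orbT.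
pose J' : {set I} := \big[@finset.setU I/@finset.set0 I]_(l <- s) J l.
apply: (@indep_integralM _ _ _ P (rv_cylinders (J k)) (rv_cylinders J')
  _ _ _ (U k) (fun w => \prod_(k <- s) U k w)%E) => //.
- exact: rv_cylinders_measurable.
- exact: rv_cylinders_measurable.
- apply: rv_cylinders_indep => //.
  rewrite /J' -finset.setI_eq0 big_distrr/=; apply/eqP/big1_seq => l /andP[_ ls].
  apply/eqP; rewrite finset.setI_eq0; apply: dJ; rewrite ?inE ?eqxx ?ls ?orbT//.
  by apply: contraNneq ks => ->.
(* Only these inclusions are kept, so that the induction on [s] can leave the sigma-algebra of [J']
   fixed. *)
- have sJ l : l \in s -> J l \subset J'.
    by move=> ls; rewrite /J' (big_rem l)//=; exact: finset.subsetUl.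
  clearbody J'; elim: s {ks us dJ ih} => [|l s ih] in sJ *.
    by under eq_fun do rewrite big_nil; exact: measurable_cst.
  under eq_fun do rewrite big_cons.
  apply: emeasurable_funM; last first.
    by apply: ih => a als; apply: sJ; rewrite inE als orbT.
  apply: g_sigma_measurable_funS (mU l).
  by apply/rv_cylindersS/sJ; rewrite inE eqxx.
- by move=> w; apply: prode_ge0.
Qed.

End blocks.

(** * Exponential bounds and the rate function *)

Section exp_bounds.
Context {R : realType}.
Implicit Types x s t u z : R.

Definition coshR (x : R) : R := (expR x + expR (- x)) / 2.

Lemma cvg_expR_series x : series (exp_coeff x) @ \oo --> expR x.
Proof. exact: is_cvg_series_exp_coeff. Qed.

Lemma cvg_coshR_series x :
  (\sum_(0 <= k < n) x ^+ k.*2 / k.*2`!%:R) @[n --> \oo] --> coshR x.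
Proof.
have -> : (fun n => \sum_(0 <= k < n) x ^+ k.*2 / k.*2`!%:R) =
    fun n => (series (exp_coeff x) n.*2 + series (exp_coeff (- x)) n.*2) / 2.
  apply/funext => n; elim: n => [|n ih].
    by rewrite /series/= !big_geq// addr0 mul0r.
  have serE y : series (exp_coeff y) n.+1.*2 = series (exp_coeff y) n.*2 +
      y ^+ n.*2 / n.*2`!%:R + y * y ^+ n.*2 / n.*2.+1`!%:R.
    rewrite /series/= doubleS (big_nat_recr n.*2.+1)// (big_nat_recr n.*2)//=.
    by rewrite /exp_coeff/= exprS.
  have x2 : (- x) ^+ n.*2 = x ^+ n.*2 by rewrite exprNn -signr_odd odd_double mul1r.
  rewrite big_nat_recr// ih !serE x2.
  by move: (n.*2`!%:R^-1) (n.*2.+1`!%:R^-1) (x ^+ n.*2) => a b c /=; field.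
have dbl : (fun n => n.*2) @ \oo --> \oo.
  move=> A [N _ NA]; exists N => // n /= Nn; apply: NA => /=.
  by rewrite (leq_trans Nn)// -addnn leq_addl.
apply: cvgMl; apply: cvgD.
- exact: (@cvg_comp _ _ _ (fun n => n.*2) (series (exp_coeff x)) _ _ _ dbl
    (@cvg_expR_series x)).
- exact: (@cvg_comp _ _ _ (fun n => n.*2) (series (exp_coeff (- x))) _ _ _ dbl
    (@cvg_expR_series (- x))).
Qed.

Lemma coshR_ge u : 1 + u ^+ 2 / 2 + u ^+ 4 / 24 <= coshR u.
Proof.
apply: (cvgr_to_ge (@cvg_coshR_series u)); exists 3%N => // n /= n3.
rewrite 3?big_ltn//; last 2 first.
- exact: ltn_trans n3.
- exact: ltn_trans n3.
rewrite !addrA expr0 -[1.*2]/2%N -[2.*2]/4%N -[0`!]/1%N -[2`!]/2%N -[4`!]/24%N divr1 lerDl.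
apply: sumr_ge0 => k _; rewrite divr_ge0// -muln2 exprM sqr_ge0//.
Qed.

(** Termwise comparison of the two series, by [2 ^ k * k! <= (2 * k)!]. This is the subgaussian
    bound for a random sign. *)
Lemma coshR_le_expR u : coshR u <= expR (u ^+ 2 / 2).
Proof.
apply: (ler_cvg_to (@cvg_coshR_series u) (@cvg_expR_series (u ^+ 2 / 2))).
apply: nearW => n; rewrite /series/=; apply: ler_sum => k _.
rewrite /exp_coeff/= -mul2n exprM expr_div_n -mulrA ler_wpM2l//.
  by rewrite exprn_ge0// sqr_ge0.
rewrite -invfM lef_pV2 ?posrE ?mulr_gt0 ?exprn_gt0 ?ltr0n ?fact_gt0//.
rewrite -natrX -natrM ler_nat.
elim: k => // k ih; rewrite mulnS !factS expnS.
rewrite [leqLHS](_ : _ = (2 * k.+1) * (2 ^ k * k`!))%N; last first.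
  by rewrite -!mulnA; congr (_ * _)%N; rewrite mulnCA.
by rewrite mulnS leq_mul// (leq_trans ih)// leq_pmull.
Qed.

(** From degree four on, each power of [s] is at most [s ^ 4]. The Taylor remainder is thus
    dominated by [s ^ 4] times a function of [u] that can be integrated, with no bound on [u]. *)
Lemma coshRM_le s u : 0 <= s <= 1 ->
  coshR (s * u) <= 1 + s ^+ 2 * u ^+ 2 / 2 + s ^+ 4 * coshR u.
Proof.
move=> /andP[s0 s1].
have cv : (1 + s ^+ 2 * u ^+ 2 / 2 +
    s ^+ 4 * \sum_(0 <= k < n) u ^+ k.*2 / k.*2`!%:R) @[n --> \oo]
    --> 1 + s ^+ 2 * u ^+ 2 / 2 + s ^+ 4 * coshR u.
  by apply: cvgD; [exact: cvg_cst|apply: cvgMr; exact: cvg_coshR_series].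
apply: (ler_cvg_to (@cvg_coshR_series (s * u)) cv).
apply: nearW; elim=> [|n ih].
  by rewrite !big_geq// mulr0 addr0 addr_ge0// divr_ge0// mulr_ge0// sqr_ge0.
have u2k k : 0 <= u ^+ k.*2 / k.*2`!%:R :> R.
  by rewrite divr_ge0// -mul2n exprM exprn_ge0// sqr_ge0.
case: n ih => [|[|n]] ih.
- rewrite !big_nat1 !expr0 -[0`!]/1%N divr1 mulr1 -addrA lerDl addr_ge0 ?exprn_ge0//.
  by rewrite divr_ge0// mulr_ge0// sqr_ge0.
- rewrite !big_nat_recr//= !big_geq// !add0r !expr0 -[0`!]/1%N.
  rewrite -[1.*2]/2%N -[2`!]/2%N !divr1 exprMn -[leLHS]addr0 lerD2l.
  by rewrite mulr_ge0 ?exprn_ge0// addr_ge0// divr_ge0// sqr_ge0.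
rewrite big_nat_recr//= [in leRHS]big_nat_recr//= mulrDr addrA lerD//.
rewrite exprMn -mulrA ler_wpM2r// !doubleS !exprS !mulrA -[leRHS]mulr1.
rewrite expr0 !mulr1 ler_piMr ?mulr_ge0// exprn_ile1//.
Qed.

Lemma expR_ge_cubic z : 0 <= z -> 1 + z + z ^+ 2 / 2 + z ^+ 3 / 6 <= expR z.
Proof.
move=> z0; apply: (cvgr_to_ge (@cvg_expR_series z)); exists 4%N => // n /= n4.
rewrite /series/= 4?big_ltn//; last 3 first.
- exact: ltn_trans n4.
- exact: ltn_trans n4.
- exact: ltn_trans n4.
rewrite !addrA /exp_coeff/= expr0 expr1 -[0`!]/1%N -[1`!]/1%N -[2`!]/2%N -[3`!]/6%N !divr1 lerDl.
by apply: sumr_ge0 => k _; rewrite divr_ge0// exprn_ge0.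
Qed.

(** The product of the cubic with [expR] has derivative [- z ^ 3 / 6 * expR z], so it decreases from
    its value [1] at [0]. *)
Lemma expRN_ge_cubic z : 0 <= z -> 1 - z + z ^+ 2 / 2 - z ^+ 3 / 6 <= expR (- z).
Proof.
move=> z0.
pose f := (fun x : R => 1 - x + x ^+ 2 / 2 - x ^+ 3 / 6) : R -> R.
pose F := fun x : R => f x * expR x.
have dF x : is_derive x 1 F (- (x ^+ 3 / 6) * expR x).
  rewrite /F /f; apply: is_derive_eq; rewrite /GRing.scale/=.
  by field.
suff : F z <= F 0.
  rewrite /F /f expR0 !expr0n/= !mul0r !subr0 addr0 mulr1 expRN.
  by rewrite -ler_pdivlMr ?expR_gt0// mul1r.
rewrite le_eqVlt in z0; case/orP: z0 => [/eqP <- //|z0].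
apply: (@ler0_derive1_le_cc R F 0 z) => //.
- move=> x; rewrite in_itv/= => /andP[x0 _].
  rewrite derive1E (@derive_val _ _ _ _ _ _ _ (dF x)) mulr_le0_ge0 ?expR_ge0//.
  by rewrite oppr_le0 divr_ge0// exprn_ge0// ltW.
- apply: continuous_subspaceT => x.
  by apply: differentiable_continuous; apply/derivable1_diffP.
- by rewrite in_itv/= lexx ltW.
- by rewrite in_itv/= lexx ltW.
- exact: ltW.
Qed.

(** Take reciprocals: [(1 - z + z ^ 2 / 2) * (1 + z + z ^ 2 / 2) = 1 + z ^ 4 / 4]. *)
Lemma expRN_le_quadratic z : 0 <= z -> expR (- z) <= 1 - z + z ^+ 2 / 2.
Proof.
move=> z0; have ez : 1 + z + z ^+ 2 / 2 <= expR z.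
  by rewrite (le_trans _ (expR_ge_cubic z0))// lerDl divr_ge0// exprn_ge0.
have h : 0 <= 1 - z + z ^+ 2 / 2 by nra.
rewrite expRN -[leLHS]mul1r ler_pdivrMr ?expR_gt0//.
apply: (@le_trans _ _ ((1 - z + z ^+ 2 / 2) * (1 + z + z ^+ 2 / 2))).
  by rewrite -subr_ge0 [X in 0 <= X](_ : _ = z ^+ 4 / 4); [rewrite divr_ge0// exprn_ge0|field].
by rewrite ler_wpM2l.
Qed.

(** Again by reciprocals. The crude cubic coefficient is enough, because the bound serves only as
    [z] tends to [0]. *)
Lemma expR_le_cubic z : 0 <= z <= 1 / 2 -> expR z <= 1 + z + z ^+ 2 / 2 + z ^+ 3.
Proof.
move=> /andP[z0 z1].
have ez := expRN_ge_cubic z0.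
set q := 1 - z + _ - _ in ez.
have q0 : 0 < q by rewrite /q; nra.
have p0 : 0 <= 1 + z + z ^+ 2 / 2 + z ^+ 3 by nra.
have pq : 1 <= (1 + z + z ^+ 2 / 2 + z ^+ 3) * q.
  rewrite -subr_ge0 [X in 0 <= X](_ : _ = z ^+ 3 *
    (5 / 6 - 11 / 12 * z + 5 / 12 * z ^+ 2 - z ^+ 3 / 6)); last first.
    by rewrite /q; field.
  by rewrite mulr_ge0 ?exprn_ge0//; nra.
rewrite -[leLHS]mul1r -[z in leLHS]opprK expRN ler_pdivrMr ?expR_gt0//.
by rewrite (le_trans pq)// ler_wpM2l.
Qed.

(** This is [ln (1 + t) <= t - t ^ 2 / 2 + t ^ 3 / 3], exponentiated. After the cubic lower bound on
    [expR], the factor [t ^ 4] splits off from the difference. *)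
Lemma upper_rate t : 0 <= t <= 1 / 2 ->
  1 + t <= expR (t - t ^+ 2 / 2 + t ^+ 3 / 3).
Proof.
move=> /andP[t0 t1].
have z0 : 0 <= t - t ^+ 2 / 2 + t ^+ 3 / 3 by nra.
apply: le_trans (expR_ge_cubic z0).
rewrite -subr_ge0 [X in 0 <= X](_ : _ = t ^+ 4 * (5 / 24 + t / 8 -
  19 / 144 * t ^+ 2 + 7 / 72 * t ^+ 3 - t ^+ 4 / 36 + t ^+ 5 / 162)); last first.
  by field.
have t2 : t ^+ 2 <= 1 / 4 by nra.
have t4 : t ^+ 4 <= 1 / 16 by rewrite (exprM t 2 2); nra.
have t3 : 0 <= t ^+ 3 by rewrite exprn_ge0.
have t5 : 0 <= t ^+ 5 by rewrite exprn_ge0.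
apply: mulr_ge0; first by rewrite exprn_ge0.
move: t2 t3 t4 t5; move: (t ^+ 2) (t ^+ 3) (t ^+ 4) (t ^+ 5) => a b c e *; lra.
Qed.

(** The left side is [1 - l + 3 / 2 * l ^ 2] at [l = t / 2]. The exponent is what remains of the
    rate [t ^ 2 / 4 - t ^ 3 / 6] once the Chernoff factor [expR (l * (1 - t))] has been accounted
    for. *)
Lemma lower_rate t : 0 <= t <= 1 / 2 ->
  1 - t / 2 + 3 * t ^+ 2 / 8 <= expR (- (t / 2 - t ^+ 2 / 4 - t ^+ 3 / 6)).
Proof.
move=> /andP[t0 t1].
have t1' : 0 <= 1 - t by lra.
have t2 : t ^+ 2 <= 1 / 4 by nra.
have z0 : 0 <= t / 2 - t ^+ 2 / 4 - t ^+ 3 / 6 by nra.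
apply: le_trans (expRN_ge_cubic z0).
rewrite -subr_ge0 [X in 0 <= X](_ : _ = t ^+ 3 * ((1 - t) / 48 +
  t ^+ 2 / 24 / 24 * (27 - 5 / 2 * t - t ^+ 2 + 2 * t ^+ 3 + 4 / 9 * t ^+ 4)));
  last by field.
have t3 : 0 <= t ^+ 3 by rewrite exprn_ge0.
have t4 : 0 <= t ^+ 4 by rewrite exprn_ge0.
apply: mulr_ge0; first exact: t3.
apply: addr_ge0; first by rewrite divr_ge0.
apply: mulr_ge0.
  by rewrite divr_ge0 ?ler0n// divr_ge0 ?ler0n// exprn_ge0.
move: t1 t3 t4 t2 {z0 t1'}; move: (t ^+ 3) (t ^+ 4) (t ^+ 2) => a b c *; lra.
Qed.

End exp_bounds.

(** * Moment generating functions of the entries *)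

Section normal.
Context {R : realType}.
Local Notation mu := (@lebesgue_measure R).

(** Change of variables by the Radon-Nikodym derivative, which equals the explicit density almost
    everywhere since both have the same integral over every measurable set. *)
Lemma integral_normal_prob (m s : R) (f : R -> \bar R) :
  measurable_fun setT f -> (forall x, 0 <= f x)%E ->
  (\int[normal_prob m s]_x f x = \int[mu]_x (f x * (normal_pdf m s x)%:E))%E.
Proof.
move=> mf f0.
have dom := @normal_prob_dominates R m s.
rewrite -(Radon_Nikodym_SigmaFinite.change_of_variables dom f0 measurableT mf).
have mpdf : measurable_fun setT (EFin \o normal_pdf m s).
  by apply/measurable_EFinP; exact: measurable_normal_pdf.
have ig := Radon_Nikodym_SigmaFinite.f_integrable dom.
apply: ae_eq_integral => //.
- by apply: emeasurable_funM => //; exact: measurable_int ig.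
- exact: emeasurable_funM.
- apply: ae_eqe_mul2l; apply: integral_ae_eq => //.
  by move=> E _ mE; rewrite -Radon_Nikodym_SigmaFinite.f_integral.
Qed.

(** Completing the square turns the integrand into a multiple of the normal density of mean
    [u * s ^ 2]. *)
Lemma normal_mgf (s u : R) : s != 0 ->
  (\int[normal_prob 0 s]_x (expR (u * x))%:E = (expR (u ^+ 2 * s ^+ 2 / 2))%:E)%E.
Proof.
move=> s0; rewrite integral_normal_prob//; last first.
  by apply/measurable_EFinP; apply: measurableT_comp => //; exact: mulrl_measurable.
transitivity (\int[mu]_x ((expR (u ^+ 2 * s ^+ 2 / 2))%:E *
    (normal_pdf (u * s ^+ 2) s x)%:E))%E.
  apply: eq_integral => x _; rewrite -!EFinM !normal_pdfE//; congr EFin.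
  rewrite /normal_fun mulrCA [RHS]mulrCA -!expRD; congr (_ * expR _).
  by field.
rewrite ge0_integralZl//.
- by rewrite integral_normal_pdf mule1.
- by apply/measurable_EFinP; exact: measurable_normal_pdf.
- by move=> x _; rewrite lee_fin normal_pdf_ge0.
Qed.

(** [E exp(l g^2) = (1 - 2 l)^(-1/2)], parametrized by the right-hand side [s]. *)
Lemma normal_mgf_sqr (s : R) : 0 < s ->
  (\int[normal_prob 0 1]_x (expR ((1 - s ^- 2) / 2 * x ^+ 2))%:E = s%:E)%E.
Proof.
move=> s0; have s0' : s != 0 by rewrite gt_eqF.
rewrite integral_normal_prob//; last first.
  apply/measurable_EFinP; apply: measurableT_comp => //.
  by apply: measurable_funM => //; exact: measurable_funX.
transitivity (\int[mu]_x (s%:E * (normal_pdf 0 s x)%:E))%E.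
  apply: eq_integral => x _; rewrite -!EFinM !normal_pdfE ?oner_neq0//; congr EFin.
  rewrite /normal_fun mulrCA -expRD [RHS]mulrA; congr (_ * expR _); last by field.
  rewrite /normal_peak expr1n mul1r -mulrnAr sqrtrM ?sqr_ge0// sqrtr_sqr gtr0_norm//.
  by rewrite invfM mulrA divff// mul1r.
rewrite ge0_integralZl//.
- by rewrite integral_normal_pdf mule1.
- by apply/measurable_EFinP; exact: measurable_normal_pdf.
- by move=> x _; rewrite lee_fin normal_pdf_ge0.
- by rewrite lee_fin ltW.
Qed.

End normal.

Section entries.
Context {d : measure_display} {T : measurableType d} {R : realType}.
Variable P : probability T R.

(** The law is known only through its two atoms. Their masses add up to [1], so the integrand equals
    a two-valued simple function almost everywhere. *)
Lemma rademacher_mgf (X : {RV P >-> R}) (s u : R) : 0 < s ->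
  P (X @^-1` [set s]) = (2^-1)%:E -> P (X @^-1` [set - s]) = (2^-1)%:E ->
  (\int[P]_w (expR (u * X w))%:E = (coshR (u * s))%:E)%E.
Proof.
move=> s0 PA PB.
set A := X @^-1` [set s] in PA; set B := X @^-1` [set - s] in PB.
have mA : measurable A by rewrite -[A]setTI; exact: measurable_funP.
have mB : measurable B by rewrite -[B]setTI; exact: measurable_funP.
have AB0 : A `&` B = set0.
  apply/seteqP; split => // w [Aw Bw]; rewrite /A /B /= in Aw Bw; lra.
have mX : measurable_fun setT (fun w => (expR (u * X w))%:E).
  apply/measurable_EFinP; apply: measurableT_comp => //.
  exact: measurable_funM.
transitivity (\int[P]_w ((expR (u * s))%:E * (\1_A w)%:E +
    (expR (- (u * s)))%:E * (\1_B w)%:E))%E.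
  apply: ae_eq_integral => //.
  - by apply: emeasurable_funD; apply: emeasurable_funM => //; apply/measurable_EFinP.
  - exists (~` (A `|` B)); split.
    + exact/measurableC/measurableU.
    + transitivity (1 - P (A `|` B))%E.
        by apply: probability_setC; exact: measurableU.
      rewrite (_ : P (A `|` B) = 1%E) ?subee//.
      transitivity (P A + P B)%E; first exact: measureU.
      by rewrite PA PB -EFinD; congr EFin; lra.
    + move=> w /= /not_implyP[_ h] ABw; apply: h; rewrite !indicE.
      case: ABw => hw.
      * rewrite mem_set// memNset ?mule1 ?mule0 ?adde0; first by rewrite hw.
        by move=> Bw; have : (A `&` B) w by []; rewrite AB0.
      * rewrite (memNset (A := A)) ?mem_set// ?mule1 ?mule0 ?add0e.
          by rewrite hw mulrN.
        by move=> Aw; have : (A `&` B) w by []; rewrite AB0.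
rewrite ge0_integralD//.
- rewrite !ge0_integralZl//; try by move=> *; rewrite lee_fin.
  + have -> : (\int[P]_x (\1_A x)%:E = P A)%E by rewrite integral_indic// setIT.
    have -> : (\int[P]_x (\1_B x)%:E = P B)%E by rewrite integral_indic// setIT.
    rewrite PA PB -!EFinM -EFinD.
    by rewrite /coshR mulrDl.
  + exact/measurable_EFinP.
  + exact/measurable_EFinP.
- by apply: emeasurable_funM => //; apply/measurable_EFinP.
- by apply: emeasurable_funM => //; apply/measurable_EFinP.
Qed.

Lemma entry_mgf (e : ensemble) (m : nat) (X : {RV P >-> R}) (u : R) :
  (0 < m)%N -> entry_law e m X ->
  exists2 M : R, (\int[P]_w (expR (u * X w))%:E = M%:E)%E &
    1 + u ^+ 2 / (2 * m%:R) <= M <= expR (u ^+ 2 / (2 * m%:R)).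
Proof.
move=> m0; rewrite /entry_law; set s := (Num.sqrt _)^-1.
have m0' : 0 < m%:R :> R by rewrite ltr0n.
have s0 : 0 < s by rewrite invr_gt0 sqrtr_gt0.
have s2 : u ^+ 2 / (2 * m%:R) = (u * s) ^+ 2 / 2.
  by rewrite exprMn /s exprVn sqr_sqrtr ?ltW// invfM mulrA [RHS]mulrAC.
rewrite s2; case: e => [law|[h1 h2]].
- exists (expR ((u * s) ^+ 2 / 2)); last by rewrite expR_ge1Dx lexx.
  rewrite exprMn -(@normal_mgf _ s u) ?(gt_eqF s0)//.
  have mf : measurable_fun setT (fun x : R => (expR (u * x))%:E).
    by apply/measurable_EFinP; apply: measurableT_comp => //; exact: mulrl_measurable.
  rewrite -(@ge0_integral_distribution _ _ _ _ _ P X (fun x => (expR (u * x))%:E))//.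
  (* The reals carry two measurable-type structures here, one under [normal_prob] and one under the
     law of [X]; the identity transports the first to the second. *)
  have mid : @measurable_fun _ _ (measurableTypeR R) R setT id.
    by move=> _ B mB; rewrite setTI.
  pose idR : {mfun measurableTypeR R >-> R} :=
    @mfun_Sub _ _ (measurableTypeR R) R id (mem_set mid).
  pose nu : probability R R := distribution (normal_prob 0 s) idR.
  transitivity (\int[nu]_x (expR (u * x))%:E)%E; last first.
    by rewrite ge0_integral_distribution.
  by apply: eq_measure_integral => B mB _; exact: law.
- exists (coshR (u * s)); first exact: rademacher_mgf.
  rewrite coshR_le_expR andbT; apply: le_trans (coshR_ge _).
  by rewrite lerDl divr_ge0// (exprM _ 2 2) sqr_ge0.
Qed.

End entries.

(** * Moments and exponential moments of the square of a subgaussian variable *)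

Section subgaussian.
Context {d : measure_display} {T : measurableType d} {R : realType}.
Variable P : probability T R.

(** The upper bound alone would allow [Y = 0]; the lower bound keeps the second moment away from
    zero. A real [M] encodes finiteness of the integral. *)
Definition std_subgaussian (Y : T -> R) : Prop :=
  measurable_fun setT Y /\
  forall s, exists2 M : R, (\int[P]_w (expR (s * Y w))%:E = M%:E)%E &
    1 + s ^+ 2 / 2 <= M <= expR (s ^+ 2 / 2).

Variable Y : T -> R.
Hypothesis sgY : std_subgaussian Y.

Let mY : measurable_fun setT Y. Proof. by case: sgY. Qed.

Let int1 : (1 = \int[P]_w (cst 1%E w))%E.
Proof. by rewrite integral_cst// mul1e; apply/esym; exact: probability_setT. Qed.

Let mexp s : measurable_fun setT (fun w => (expR (s * Y w))%:E).
Proof.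
by apply/measurable_EFinP; apply: measurableT_comp => //; exact: measurable_funM.
Qed.

Let mpow k : measurable_fun setT (fun w => (Y w ^+ k)%:E).
Proof. by apply/measurable_EFinP; exact: measurable_funX. Qed.

Let mpowc k c : measurable_fun setT (fun w => (c%:E * (Y w ^+ k)%:E)%E).
Proof. by apply: emeasurable_funM => //; exact: measurable_cst. Qed.

(** Averaging the bounds at [s] and [- s] leaves only even powers of [Y], which are nonnegative and
    can be integrated term by term. *)
Lemma subgaussian_cosh s : exists2 M : R,
  (\int[P]_w (coshR (s * Y w))%:E = M%:E)%E &
  1 + s ^+ 2 / 2 <= M <= expR (s ^+ 2 / 2).
Proof.
have [_ h] := sgY; have [M1 e1 /andP[a1 b1]] := h s.
have [M2 e2 /andP[a2 b2]] := h (- s).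
rewrite sqrrN in a2 b2; exists ((M1 + M2) / 2); last by apply/andP; split; lra.
transitivity (\int[P]_w ((2^-1)%:E * ((expR (s * Y w))%:E + (expR (- s * Y w))%:E)))%E.
  by apply: eq_integral => w _; rewrite -EFinD -EFinM /coshR mulNr mulrC.
rewrite ge0_integralZl//; last 2 first.
- exact: emeasurable_funD.
- by move=> w _; rewrite adde_ge0// lee_fin expR_ge0.
rewrite ge0_integralD//; try by move=> w _; rewrite lee_fin expR_ge0.
by rewrite e1 e2 -EFinD -EFinM mulrC.
Qed.

Let mcosh s : measurable_fun setT (fun w => (coshR (s * Y w))%:E).
Proof.
apply/measurable_EFinP; apply: measurable_funM => //.
apply: measurable_funD; apply: measurableT_comp => //; first exact: measurable_funM.
by apply: measurableT_comp => //; exact: measurable_funM.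
Qed.

Let pow_ge0 k c w : 0 <= c -> ~~ odd k -> (0 <= c%:E * (Y w ^+ k)%:E)%E.
Proof.
by move=> c0 ok; rewrite mule_ge0 ?lee_fin// -[k]odd_double_half (negbTE ok)
  add0n -mul2n exprM exprn_ge0// sqr_ge0.
Qed.

(** Compare the coefficients of [s^2] and [s^4] in the two bounds on
    [E cosh(s Y)], letting [s] tend to [0]. *)
Lemma subgaussian_moments : exists a b : R,
  [/\ (\int[P]_w (Y w ^+ 2)%:E = a%:E)%E, (\int[P]_w (Y w ^+ 4)%:E = b%:E)%E,
      1 <= a, 0 <= b & b <= 3].
Proof.
have intD s : 0 <= s -> (1 + (s ^+ 2 / 2)%:E * \int[P]_w (Y w ^+ 2)%:E +
    (s ^+ 4 / 24)%:E * \int[P]_w (Y w ^+ 4)%:E <=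
    \int[P]_w (coshR (s * Y w))%:E)%E.
  move=> s0.
  rewrite int1.
  rewrite -!ge0_integralZl//; try by move=> w _; rewrite lee_fin ?sqr_ge0// (exprM _ 2 2) sqr_ge0.
  - rewrite -!ge0_integralD//.
    + apply: ge0_le_integral => //.
      * by move=> w _; rewrite !adde_ge0// pow_ge0// divr_ge0// exprn_ge0.
      * by do 2! apply: emeasurable_funD => //.
      * move=> w _ /=; rewrite -!EFinM -!EFinD lee_fin.
        apply: le_trans (coshR_ge _); rewrite !exprMn.
        by rewrite [s ^+ 2 / _ * _]mulrAC [s ^+ 4 / _ * _]mulrAC.
    + by move=> w _; rewrite !adde_ge0// pow_ge0// divr_ge0// exprn_ge0.
    + by apply: emeasurable_funD.
    + by move=> w _; rewrite pow_ge0// divr_ge0// exprn_ge0.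
    + by move=> w _; rewrite pow_ge0// divr_ge0// exprn_ge0.
  - by rewrite lee_fin divr_ge0// exprn_ge0.
  - by rewrite lee_fin divr_ge0// exprn_ge0.
have Y2ge : (0 <= \int[P]_w (Y w ^+ 2)%:E)%E.
  by apply: integral_ge0 => w _; rewrite lee_fin sqr_ge0.
have Y4ge : (0 <= \int[P]_w (Y w ^+ 4)%:E)%E.
  by apply: integral_ge0 => w _; rewrite lee_fin (exprM _ 2 2) sqr_ge0.
(* At [s = 1] the right side of [intD] is finite, which excludes infinite moments. *)
have [Y2fin Y4fin] : (\int[P]_w (Y w ^+ 2)%:E)%E \is a fin_num /\
    (\int[P]_w (Y w ^+ 4)%:E)%E \is a fin_num.
  have := intD 1 ler01; have [M -> _] := subgaussian_cosh 1.
  move: Y2ge Y4ge; rewrite !expr1n.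
  case: (integral _ _ _) => [x| |]//; case: (integral _ _ _) => [y| |]//.
  - by rewrite gt0_muley ?lte_fin// -!EFinM -EFinD.
  - by rewrite gt0_muley ?lte_fin// -!EFinM addye// leye_eq.
  - by rewrite !gt0_muley ?lte_fin.
pose a := fine (\int[P]_w (Y w ^+ 2)%:E)%E.
pose b := fine (\int[P]_w (Y w ^+ 4)%:E)%E.
have aE : (\int[P]_w (Y w ^+ 2)%:E = a%:E)%E by rewrite fineK.
have bE : (\int[P]_w (Y w ^+ 4)%:E = b%:E)%E by rewrite fineK.
clearbody a b; exists a, b.
have b0 : 0 <= b by rewrite -lee_fin -bE.
have low s : 0 <= s -> 1 + s ^+ 2 / 2 * a + s ^+ 4 / 24 * b <= expR (s ^+ 2 / 2).
  move=> s0; have := intD s s0; have [M -> /andP[_ Ms]] := subgaussian_cosh s.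
  by rewrite aE bE -!EFinM -!EFinD lee_fin => /le_trans; exact.
have [M1 M1E _] := subgaussian_cosh 1.
have upp s : 0 <= s <= 1 -> s ^+ 2 / 2 <= s ^+ 2 / 2 * a + s ^+ 4 * M1.
  move=> s01; have [s0 s1] := andP s01.
  have [M ME /andP[Ms _]] := subgaussian_cosh s.
  have : (M%:E <= 1 + (s ^+ 2 / 2)%:E * a%:E + (s ^+ 4)%:E * M1%:E)%E.
    rewrite -ME -M1E -aE.
    rewrite int1.
    rewrite -!ge0_integralZl//; try by move=> w _;
      rewrite lee_fin ?sqr_ge0// divr_ge0// addr_ge0// expR_ge0.
    - rewrite -!ge0_integralD//.
      + apply: ge0_le_integral => //.
        * by move=> w _; rewrite lee_fin divr_ge0// addr_ge0// expR_ge0.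
        * apply: emeasurable_funD; first exact: emeasurable_funD.
          by apply: emeasurable_funM => //; exact: measurable_cst.
        * move=> w _ /=; rewrite -!EFinM -!EFinD lee_fin mul1r.
          by apply: le_trans (coshRM_le _ s01) _; rewrite mulrAC.
      + by move=> w _; rewrite !adde_ge0// pow_ge0// divr_ge0// exprn_ge0.
      + by apply: emeasurable_funD.
      + move=> w _; rewrite -EFinM lee_fin mulr_ge0 ?exprn_ge0//.
        by rewrite divr_ge0// addr_ge0// expR_ge0.
      + by apply: emeasurable_funM => //; exact: measurable_cst.
      + by move=> w _; rewrite pow_ge0// divr_ge0// exprn_ge0.
    - by rewrite lee_fin exprn_ge0.
    - by rewrite lee_fin divr_ge0// exprn_ge0.
  rewrite -!EFinM -!EFinD lee_fin => h.
  by have := le_trans Ms h; lra.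
have M10 : 0 <= M1.
  rewrite -lee_fin -M1E; apply: integral_ge0 => w _.
  by rewrite lee_fin divr_ge0// addr_ge0// expR_ge0.
have a1 : 1 <= a.
  apply/ler_addgt0Pr => e e0.
  (* With [q = s ^ 2], [upp] reads [1 <= a + 2 * q * M1]; the summand [1] keeps [K] positive. *)
  pose K := 2 * M1 + 1; have K0 : 0 < K by rewrite /K; lra.
  pose q := Num.min 1 (e / K); have q0 : 0 < q by rewrite lt_min ltr01 divr_gt0.
  have q1 : q <= 1 by rewrite ge_min lexx.
  have qe : q * K <= e by rewrite -ler_pdivlMr// ge_min lexx orbT.
  have sq : Num.sqrt q ^+ 2 = q by rewrite sqr_sqrtr// ltW.
  have s01 : 0 <= Num.sqrt q <= 1 by rewrite sqrtr_ge0 -[leRHS]sqrtr1 ler_wsqrtr.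
  have := upp _ s01; rewrite (exprM _ 2 2) sq => h.
  have : q * 1 <= q * (a + e); last by rewrite ler_pM2l.
  by rewrite /K in qe; nra.
split => //.
apply/ler_addgt0Pr => e e0.
(* With [q = s ^ 2] and [1 <= a], the terms of order [q] cancel and leave [b / 24 <= 1 / 8 + q / 8].
   The limit [3] is the Gaussian fourth moment. *)
pose q := Num.min 1 (e / 3); have q0 : 0 < q by rewrite lt_min ltr01 divr_gt0.
have q1 : q <= 1 by rewrite ge_min lexx.
have qe : q * 3 <= e by rewrite -ler_pdivlMr// ge_min lexx orbT.
have sq : Num.sqrt q ^+ 2 = q by rewrite sqr_sqrtr// ltW.
have := low _ (sqrtr_ge0 q); rewrite (exprM _ 2 2) sq => h.
have hq : 0 <= q / 2 <= 1 / 2 by apply/andP; split; lra.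
have := le_trans h (expR_le_cubic hq) => h'.
have : q ^+ 2 * b <= q ^+ 2 * (3 + e); last by rewrite ler_pM2l// exprn_gt0.
have q3 : q ^+ 3 * 3 <= q ^+ 2 * e by rewrite exprSr -mulrA ler_wpM2l// exprn_ge0// ltW.
have qa : q <= q * a by rewrite ler_peMr// ltW.
by move: h' q3 qa; rewrite !expr_div_n; clearbody q; move: (q ^+ 3) (q ^+ 2) => *; lra.
Qed.

(** Integrate [exp (- z) <= 1 - z + z ^ 2 / 2] at [z = l * Y ^ 2] and insert the moment bounds. The
    linear term is first moved to the left, so that only nonnegative functions are integrated. *)
Lemma subgaussian_sqr_mgf_neg l : 0 <= l ->
  (\int[P]_w (expR (- (l * Y w ^+ 2)))%:E <= (1 - l + 3 / 2 * l ^+ 2)%:E)%E.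
Proof.
move=> l0; have [a [b [aE bE a1 b0 b3]]] := subgaussian_moments.
have mneg : measurable_fun setT (fun w => (expR (- (l * Y w ^+ 2)))%:E).
  apply/measurable_EFinP; apply: measurableT_comp => //; apply: measurableT_comp => //.
  by apply: measurable_funM => //; exact: measurable_funX.
have : (\int[P]_w (expR (- (l * Y w ^+ 2)))%:E + l%:E * a%:E <=
    1 + (l ^+ 2 / 2)%:E * b%:E)%E.
  rewrite -aE -bE.
  rewrite int1.
  rewrite -!ge0_integralZl//; try by move=> w _; rewrite lee_fin ?sqr_ge0// (exprM _ 2 2) sqr_ge0.
  - rewrite -!ge0_integralD//.
    + apply: ge0_le_integral => //.
      * by move=> w _; rewrite adde_ge0// ?pow_ge0// lee_fin expR_ge0.
      * exact: emeasurable_funD.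
      * exact: emeasurable_funD.
      * move=> w _ /=; rewrite -!EFinM -!EFinD lee_fin.
        have z0 : 0 <= l * Y w ^+ 2 by rewrite mulr_ge0// sqr_ge0.
        have := expRN_le_quadratic z0; rewrite exprMn -exprM -[(2 * 2)%N]/4%N.
        move: (expR (- (l * Y w ^+ 2))) (Y w ^+ 2) (Y w ^+ 4) (l ^+ 2) => *; lra.
    + by move=> w _; rewrite pow_ge0// divr_ge0// exprn_ge0.
    + by move=> w _; rewrite pow_ge0.
  - by rewrite lee_fin divr_ge0// exprn_ge0.
have : (0 <= \int[P]_w (expR (- (l * Y w ^+ 2)))%:E)%E.
  by apply: integral_ge0 => w _; rewrite lee_fin expR_ge0.
case: (integral _ _ _) => [x| |]// _.
rewrite -!EFinM -!EFinD !lee_fin => h.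
have l2 : 0 <= l ^+ 2 by rewrite sqr_ge0.
have h1 : l <= l * a by rewrite ler_peMr.
have h2 : l ^+ 2 * b <= l ^+ 2 * 3 by rewrite ler_wpM2l.
by move: h h1 h2; move: (l * a) (l ^+ 2) => *; lra.
Qed.

(** [exp(l Y^2) = E_g exp((2 l)^(1/2) g Y)] for an auxiliary standard Gaussian
    [g]; exchanging the integrals reduces [Y] to the Gaussian case. *)
Lemma subgaussian_sqr_mgf s : 1 <= s ->
  (\int[P]_w (expR ((1 - s ^- 2) / 2 * Y w ^+ 2))%:E <= s%:E)%E.
Proof.
move=> s1; have s0 : 0 < s by rewrite (lt_le_trans _ s1).
set l := (1 - s ^- 2) / 2.
have l0 : 0 <= l.
  by rewrite divr_ge0// subr_ge0 invf_le1 ?exprn_gt0// exprn_ege1.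
pose c := Num.sqrt (2 * l).
have c2 : c ^+ 2 = 2 * l by rewrite sqr_sqrtr// mulr_ge0.
pose f (z : T * measurableTypeR R) := (expR (c * Y z.1 * (z.2 : R)))%:E.
have mf : measurable_fun setT f.
  apply/measurable_EFinP; apply: measurableT_comp => //.
  apply: measurable_funM; last exact: measurable_snd.
  by apply: measurable_funM => //; exact: measurableT_comp.
have f0 z : (0 <= f z)%E by rewrite lee_fin expR_ge0.
have -> : (\int[P]_w (expR (l * Y w ^+ 2))%:E =
    \int[P]_w \int[normal_prob 0 1]_g f (w, g))%E.
  apply: eq_integral => w _.
  transitivity (expR ((c * Y w) ^+ 2 * 1 ^+ 2 / 2))%:E.
    by rewrite expr1n mulr1 exprMn c2; congr (expR _)%:E; field.
  have u1 : (1 : R) != 0 by exact: oner_neq0.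
  have := normal_mgf (c * Y w) u1.
  by move=> <-.
rewrite (fubini_tonelli (m1 := P) (m2 := normal_prob 0 1))//.
rewrite -[leRHS](normal_mgf_sqr s0).
apply: ge0_le_integral => //.
- by move=> g _; exact: integral_ge0.
- exact: (measurable_fun_fubini_tonelli_G (m1 := P)).
- apply/measurable_EFinP; apply: measurableT_comp => //.
  by apply: measurable_funM => //; exact: measurable_funX.
- move=> g _; rewrite /f/=.
  have [_ /(_ (c * g)) [M ME /andP[_ Ms]]] := sgY.
  under eq_integral do rewrite mulrAC.
  rewrite ME lee_fin (le_trans Ms)// exprMn c2 -/l.
  by rewrite ler_expR; lra.
Qed.

End subgaussian.

(** * Concentration of the norm of a random image *)

Definition sqnorm {R : realType} {k : nat} (x : 'cV[R]_k) : R :=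
  \sum_i x i 0 ^+ 2.

(** This carries the lower bound [1 + s ^ 2 / 2] from the entries to a row: the cross terms of the
    product are nonnegative. *)
Lemma prodr_1D_ge {R : realDomainType} (I : Type) (s : seq I) (c M : I -> R) :
  (forall i, 0 <= c i) -> (forall i, 1 + c i <= M i) ->
  1 + \sum_(i <- s) c i <= \prod_(i <- s) M i.
Proof.
move=> c0 cM; elim: s => [|i s ih]; first by rewrite !big_nil addr0.
have S0 : 0 <= \sum_(j <- s) c j by exact: sumr_ge0.
rewrite !big_cons; apply: le_trans (ler_pM _ _ (cM i) ih); last 2 first.
- by rewrite addr_ge0.
- by rewrite addr_ge0.
rewrite -subr_ge0 [X in 0 <= X](_ : _ = c i * \sum_(j <- s) c j); last by ring.
by rewrite mulr_ge0.
Qed.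

Lemma prode_ord_le_const {R : realType} (m : nat) (a : 'I_m -> \bar R) (c : R) :
  (forall i, 0 <= a i <= c%:E)%E -> (\prod_i a i <= (c ^+ m)%:E)%E.
Proof.
elim: m a => [|m ih] a ac; first by rewrite big_ord0.
have /andP[a0 ac0] := ac ord0.
rewrite big_ord_recl exprS EFinM lee_pmul// ?ih//.
by apply: prode_ge0 => j _; have /andP[] := ac (lift ord0 j).
Qed.

Lemma measurable_ge_set {d} {T : measurableType d} {R : realType} (f : T -> R) (c : R) :
  measurable_fun setT f -> measurable [set w | c <= f w].
Proof.
move=> mf; rewrite (_ : [set w | _] = f @^-1` `[c, +oo[).
  by rewrite -[X in measurable X]setTI; exact: mf.
by apply/seteqP; split => w /=; rewrite in_itv/= andbT.
Qed.

Lemma measurable_le_set {d} {T : measurableType d} {R : realType} (f : T -> R) (c : R) :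
  measurable_fun setT f -> measurable [set w | f w <= c].
Proof.
move=> mf; rewrite (_ : [set w | _] = f @^-1` `]-oo, c]).
  by rewrite -[X in measurable X]setTI; exact: mf.
by apply/seteqP; split => w /=; rewrite in_itv/=.
Qed.

Section concentration.
Context {d : measure_display} {T : measurableType d} {R : realType}.
Variable P : probability T R.

Lemma expR_markov (Z : T -> R) : measurable_fun setT Z ->
  (P [set w | (0 <= Z w)%R] <= \int[P]_w (expR (Z w))%:E)%E.
Proof.
move=> mZ.
have mA := measurable_ge_set 0 mZ.
set B := [set w | _] in mA *.
have -> : (P B = \int[P]_w (\1_B w)%:E)%E by rewrite integral_indic// setIT.
apply: ge0_le_integral => //.
- exact/measurable_EFinP.
- by apply/measurable_EFinP; exact: measurableT_comp.
- move=> w _; rewrite lee_fin indicE.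
  have [Bw|_] := boolP (w \in B); last exact: expR_ge0.
  by rewrite inE in Bw; rewrite -expR0 ler_expR.
Qed.

Variables (e : ensemble) (m n : nat) (A : 'M[{RV P >-> R}]_(m, n)).
Hypotheses (m0 : (0 < m)%N) (hA : random_subgaussian e A).

Let X (ij : 'I_m * 'I_n) : {RV P >-> R} := A ij.1 ij.2.

(** The sigma-algebra is left open because independence of the rows needs measurability with respect
    to the entries of row [i] alone. *)
Lemma measurable_rowmul (x : 'cV[R]_n) i (G : set (set T)) :
  (forall j, measurable_fun setT (A i j : g_sigma_algebraType G -> R)) ->
  measurable_fun setT
    ((fun w => (rmx_at A w *m x) i 0) : g_sigma_algebraType G -> R).
Proof.
move=> mA.
have -> : (fun w => (rmx_at A w *m x) i 0) = (fun w => \sum_j A i j w * x j 0).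
  by apply/funext => w; rewrite mxE; apply: eq_bigr => j _; rewrite mxE.
apply: measurable_sum => j; apply: measurable_funM => //.
Qed.

(** The moment generating function factors over the entries of the row, and for a unit vector the
    exponents [u j ^ 2 / (2 * m)] add up to [s ^ 2 / 2], so both bounds are reproduced. *)
Lemma row_subgaussian (x : 'cV[R]_n) i : sqnorm x = 1 ->
  std_subgaussian P (fun w => Num.sqrt m%:R * (rmx_at A w *m x) i 0).
Proof.
move=> x1; have [ind law] := hA.
have m0' : 0 < m%:R :> R by rewrite ltr0n.
split.
  apply: measurable_funM => //.
  have -> : (fun w => (rmx_at A w *m x) i 0) = (fun w => \sum_j A i j w * x j 0).
    by apply/funext => w; rewrite mxE; apply: eq_bigr => j _; rewrite mxE.
  by apply: measurable_sum => j; exact: measurable_funM.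
move=> s; pose u j := s * Num.sqrt m%:R * x j 0.
pose U (j : 'I_n) (w : T) := (expR (u j * A i j w))%:E.
have M_ j : {M : R | (\int[P]_w U j w = M%:E)%E &
    1 + u j ^+ 2 / (2 * m%:R) <= M <= expR (u j ^+ 2 / (2 * m%:R))}.
  by apply/cid2; exact: entry_mgf (law i j).
pose M j := s2val (M_ j).
have ME j : (\int[P]_w U j w = (M j)%:E)%E by exact: (s2valP (M_ j)).
have Mb j : 1 + u j ^+ 2 / (2 * m%:R) <= M j <= expR (u j ^+ 2 / (2 * m%:R)).
  exact: (s2valP' (M_ j)).
have usum : \sum_j u j ^+ 2 / (2 * m%:R) = s ^+ 2 / 2.
  rewrite -[RHS]mulr1 -[X in _ = _ * X]x1 mulr_sumr; apply: eq_bigr => j _.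
  rewrite /u !exprMn sqr_sqrtr ?ltW//; field.
  by rewrite gt_eqF.
exists (\prod_j M j); last first.
  apply/andP; split.
    rewrite -usum; apply: prodr_1D_ge => j; last by case/andP: (Mb j).
    by rewrite divr_ge0 ?sqr_ge0// mulr_ge0// ltW.
  rewrite -usum expR_sum; apply: ler_prod => j _.
  have /andP[h ->] := Mb j; rewrite andbT (le_trans _ h)// addr_ge0//.
  by rewrite divr_ge0 ?sqr_ge0// mulr_ge0// ltW.
transitivity (\int[P]_w \prod_(j <- index_enum 'I_n) U j w)%E.
  apply: eq_integral => w _; rewrite /U prodEFin -expR_sum; congr (expR _)%:E.
  rewrite mxE mulrA mulr_sumr; apply: eq_bigr => j _.
  by rewrite mxE /u [RHS]mulrAC mulrA.
rewrite (@integral_prod_indep _ _ _ P _ X _ (index_enum 'I_n)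
   (fun j => finset.set1 (i, j)) U)//.
- by rewrite -prodEFin; apply: eq_bigr => j _; exact: ME.
- exact: index_enum_uniq.
- move=> j k _ _ jk; rewrite finset.disjoints1 inE.
  by apply: contra jk => /eqP[->].
- move=> j; apply/measurable_EFinP; apply: measurableT_comp => //.
  apply: measurable_funM => //.
  by apply: (@measurable_rv_cylinders _ _ _ P _ X _ (i, j)); rewrite inE.
- by move=> k w; rewrite lee_fin expR_ge0.
Qed.

Lemma integral_prod_rows (x : 'cV[R]_n) (h : R -> R) :
  measurable_fun setT h -> (forall y, 0 <= h y) ->
  (\int[P]_w (\prod_i h ((rmx_at A w *m x) i 0))%:E =
   \prod_i \int[P]_w (h ((rmx_at A w *m x) i 0))%:E)%E.
Proof.
move=> mh h0; have [ind law] := hA.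
transitivity (\int[P]_w \prod_(i <- index_enum 'I_m)
    (h ((rmx_at A w *m x) i 0))%:E)%E.
  by apply: eq_integral => w _; rewrite prodEFin.
apply: (@integral_prod_indep _ _ _ P _ X _ (index_enum 'I_m)
   (fun i => [set ij | ij.1 == i]%SET)
   (fun i w => (h ((rmx_at A w *m x) i 0))%:E)) => //.
- exact: index_enum_uniq.
- move=> i k _ _ ik; rewrite -finset.setI_eq0; apply/eqP/finset.setP => -[a b].
  rewrite !inE/=; apply/negP => /andP[/eqP -> /eqP ik'].
  by rewrite ik' eqxx in ik.
- move=> i; apply/measurable_EFinP; apply: measurableT_comp => //.
  apply: measurable_rowmul => j.
  by apply: (@measurable_rv_cylinders _ _ _ P _ X _ (i, j)); rewrite inE.
- by move=> k w; rewrite lee_fin.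
Qed.

Let mrow (x : 'cV[R]_n) i : measurable_fun setT (fun w => (rmx_at A w *m x) i 0).
Proof.
have -> : (fun w => (rmx_at A w *m x) i 0) = (fun w => \sum_j A i j w * x j 0).
  by apply/funext => w; rewrite mxE; apply: eq_bigr => j _; rewrite mxE.
by apply: measurable_sum => j; exact: measurable_funM.
Qed.

(** The threshold of the deviation is spread evenly over the rows inside [g], so the event is a sign
    condition on a sum whose exponential factors. *)
Lemma rows_chernoff (x : 'cV[R]_n) (g : R -> R) (c : R) :
  measurable_fun setT g ->
  (forall i, \int[P]_w (expR (g ((rmx_at A w *m x) i 0)))%:E <= (expR c)%:E)%E ->
  (P [set w | (0 <= \sum_i g ((rmx_at A w *m x) i 0))%R] <=
   (expR (m%:R * c))%:E)%E.
Proof.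
move=> mg gc; apply: le_trans (expR_markov _) _.
  by apply: measurable_sum => i; exact: measurableT_comp.
under eq_integral do rewrite expR_sum.
rewrite (integral_prod_rows x (h := fun y => expR (g y))); last 2 first.
- exact: measurableT_comp.
- by move=> y; exact: expR_ge0.
rewrite expRM_natl; apply: prode_ord_le_const => i; rewrite gc andbT.
by apply: integral_ge0 => w _; rewrite lee_fin expR_ge0.
Qed.

Let rowE (x : 'cV[R]_n) i w (l : R) :
  l * m%:R * (rmx_at A w *m x) i 0 ^+ 2 =
  l * (Num.sqrt m%:R * (rmx_at A w *m x) i 0) ^+ 2.
Proof. by rewrite -mulrA; congr (_ * _); rewrite exprMn sqr_sqrtr// ler0n. Qed.

Let row_factor (x : 'cV[R]_n) i (l a : R) :
  (\int[P]_w (expR (l * m%:R * (rmx_at A w *m x) i 0 ^+ 2 + a))%:E =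
   (expR a)%:E *
   \int[P]_w (expR (l * (Num.sqrt m%:R * (rmx_at A w *m x) i 0) ^+ 2))%:E)%E.
Proof.
rewrite -ge0_integralZl//.
- by apply: eq_integral => w _; rewrite -EFinM -expRD addrC -rowE.
- apply/measurable_EFinP; apply: measurableT_comp => //.
  apply: measurable_funM => //; apply: measurable_funX.
  exact: measurable_funM.
Qed.

Let sum_row (x : 'cV[R]_n) w (l a : R) :
  \sum_i (l * m%:R * (rmx_at A w *m x) i 0 ^+ 2 + a) =
  m%:R * (l * sqnorm (rmx_at A w *m x) + a).
Proof.
rewrite big_split/= -mulr_sumr sumr_const card_ord -/(sqnorm _) -[a *+ m]mulr_natl.
by ring.
Qed.

Lemma measurable_fun_sqnorm (x : 'cV[R]_n) :
  measurable_fun setT (fun w => sqnorm (rmx_at A w *m x)).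
Proof. by apply: measurable_sum => i; exact: measurable_funX. Qed.

(** The optimal exponent [l] satisfies [1 - 2 l = (1 + t)^-1]. *)
Lemma upper_tail (x : 'cV[R]_n) (t : R) : sqnorm x = 1 -> 0 <= t <= 1 / 2 ->
  (P [set w | (1 + t <= sqnorm (rmx_at A w *m x))%R] <=
   (expR (- (m%:R * (t ^+ 2 / 4 - t ^+ 3 / 6))))%:E)%E.
Proof.
move=> x1 t01; have [t0 t1] := andP t01.
have m0' : 0 < m%:R :> R by rewrite ltr0n.
pose s := Num.sqrt (1 + t); have s2 : s ^+ 2 = 1 + t by rewrite sqr_sqrtr// addr_ge0.
have s1 : 1 <= s by rewrite -[leLHS]sqrtr1 ler_wsqrtr// lerDl.
pose l := (1 - s ^- 2) / 2.
have lE : l * (1 + t) = t / 2 by rewrite /l s2; field; rewrite gt_eqF// ltr_wpDr.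
have l0 : 0 <= l by rewrite divr_ge0// subr_ge0 s2 invf_le1 ?lerDl// ltr_wpDr.
pose g (y : R) := l * m%:R * y ^+ 2 + - (t / 2).
have mg : measurable_fun setT g.
  by apply: measurable_funD => //; apply: measurable_funM => //; exact: measurable_funX.
have sle : s <= expR (t / 2 - t ^+ 2 / 4 + t ^+ 3 / 6).
  rewrite -(ler_pXn2r (n := 2)) ?nnegrE ?expR_ge0 ?(le_trans ler01)//.
  rewrite s2 -expRM_natl; apply: le_trans (upper_rate t01) _.
  by rewrite ler_expR; lra.
rewrite -mulrN; apply: le_trans (rows_chernoff (x := x) (g := g) mg _); last first.
  move=> i; rewrite row_factor.
  apply: (@le_trans _ _ ((expR (- (t / 2)))%:E * s%:E)%E).
    rewrite lee_wpmul2l ?lee_fin ?expR_ge0//.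
    exact: (subgaussian_sqr_mgf (row_subgaussian i x1) s1).
  rewrite -EFinM lee_fin (le_trans (ler_wpM2l (expR_ge0 _) sle))// -expRD ler_expR.
  lra.
apply: le_measure; rewrite ?inE.
- exact: measurable_ge_set (measurable_fun_sqnorm x).
- apply: measurable_ge_set; apply: measurable_sum => i.
  exact: measurableT_comp.
- move=> w /= h; rewrite sum_row mulr_ge0// -lE -mulrBr mulr_ge0//.
  by rewrite subr_ge0.
Qed.

(** Per row, the logarithm of the Chernoff bound is [- l * t + l ^ 2] to second order, which is
    least at [l = t / 2]. *)
Lemma lower_tail (x : 'cV[R]_n) (t : R) : sqnorm x = 1 -> 0 <= t <= 1 / 2 ->
  (P [set w | (sqnorm (rmx_at A w *m x) <= 1 - t)%R] <=
   (expR (- (m%:R * (t ^+ 2 / 4 - t ^+ 3 / 6))))%:E)%E.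
Proof.
move=> x1 t01; have [t0 t1] := andP t01.
have m0' : 0 < m%:R :> R by rewrite ltr0n.
pose l := t / 2; have l0 : 0 <= l by rewrite divr_ge0.
pose g (y : R) := - l * m%:R * y ^+ 2 + l * (1 - t).
have mg : measurable_fun setT g.
  by apply: measurable_funD => //; apply: measurable_funM => //; exact: measurable_funX.
rewrite -mulrN; apply: le_trans (rows_chernoff (x := x) (g := g) mg _); last first.
  move=> i; rewrite row_factor.
  apply: (@le_trans _ _ ((expR (l * (1 - t)))%:E * (1 - l + 3 / 2 * l ^+ 2)%:E)%E).
    rewrite lee_wpmul2l ?lee_fin ?expR_ge0//.
    under eq_integral do rewrite mulNr.
    exact: (subgaussian_sqr_mgf_neg (row_subgaussian i x1) l0).
  rewrite -EFinM lee_fin (_ : 1 - l + _ = 1 - t / 2 + 3 * t ^+ 2 / 8); last first.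
    by rewrite /l; field.
  rewrite (le_trans (ler_wpM2l (expR_ge0 _) (lower_rate t01)))// -expRD ler_expR.
  by rewrite /l; lra.
apply: le_measure; rewrite ?inE.
- exact: measurable_le_set (measurable_fun_sqnorm x).
- apply: measurable_ge_set; apply: measurable_sum => i.
  exact: measurableT_comp.
- move=> w /= h; rewrite sum_row mulr_ge0// mulNr addrC -mulrBr mulr_ge0//.
  by rewrite subr_ge0.
Qed.

End concentration.

(** * Euclidean geometry *)

Section euclid.
Context {R : realType}.

Definition dot {k : nat} (x y : 'cV[R]_k) : R := \sum_i x i 0 * y i 0.

Lemma sqnorm_ge0 k (x : 'cV[R]_k) : 0 <= sqnorm x.
Proof. by apply: sumr_ge0 => i _; exact: sqr_ge0. Qed.

Lemma dotxx k (x : 'cV[R]_k) : dot x x = sqnorm x.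
Proof. by apply: eq_bigr => i _; rewrite expr2. Qed.

Lemma dotE k (x y : 'cV[R]_k) : dot x y = (x^T *m y) 0 0.
Proof. by rewrite mxE; apply: eq_bigr => i _; rewrite mxE. Qed.

Lemma sqnorm_eq0 k (x : 'cV[R]_k) : (sqnorm x == 0) = (x == 0).
Proof.
apply/eqP/eqP => [/eqP|->]; last by rewrite /sqnorm big1// => i _; rewrite mxE expr0n.
rewrite psumr_eq0; last by move=> i _; exact: sqr_ge0.
move=> /allP h; apply/colP => i; rewrite mxE.
by have := h i (mem_index_enum _); rewrite sqrf_eq0 => /eqP.
Qed.

Lemma sqnormZ k c (x : 'cV[R]_k) : sqnorm (c *: x) = c ^+ 2 * sqnorm x.
Proof. by rewrite /sqnorm mulr_sumr; apply: eq_bigr => i _; rewrite mxE exprMn. Qed.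

Lemma sqnormD k (x y : 'cV[R]_k) :
  sqnorm (x + y) = sqnorm x + 2 * dot x y + sqnorm y.
Proof.
rewrite /sqnorm /dot mulr_sumr -!big_split/=; apply: eq_bigr => i _.
by rewrite mxE; ring.
Qed.

Lemma sqnormN k (x : 'cV[R]_k) : sqnorm (- x) = sqnorm x.
Proof. by rewrite -scaleN1r sqnormZ sqrrN expr1n mul1r. Qed.

Lemma dotNr k (x y : 'cV[R]_k) : dot x (- y) = - dot x y.
Proof. by rewrite /dot -sumrN; apply: eq_bigr => i _; rewrite mxE mulrN. Qed.

Lemma dotZr k c (x y : 'cV[R]_k) : dot x (c *: y) = c * dot x y.
Proof. by rewrite /dot mulr_sumr; apply: eq_bigr => i _; rewrite mxE mulrCA. Qed.

Lemma sqnormB k (x y : 'cV[R]_k) :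
  sqnorm (x - y) = sqnorm x - 2 * dot x y + sqnorm y.
Proof. by rewrite sqnormD sqnormN dotNr mulrN. Qed.

Lemma cauchy_schwarz k (x y : 'cV[R]_k) : dot x y ^+ 2 <= sqnorm x * sqnorm y.
Proof.
have [/eqP|y0] := eqVneq (sqnorm y) 0.
  rewrite sqnorm_eq0 => /eqP ->; rewrite /dot big1 ?expr0n/=; last first.
    by move=> i _; rewrite mxE mulr0.
  by rewrite mulr_ge0 ?sqnorm_ge0.
have yp : 0 < sqnorm y by rewrite lt0r y0 sqnorm_ge0.
have := sqnorm_ge0 (x - (dot x y / sqnorm y) *: y).
rewrite sqnormB sqnormZ dotZr => h.
rewrite -ler_pdivrMr// -subr_ge0 (le_trans h)// le_eqVlt; apply/orP; left.
by apply/eqP; field.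
Qed.

Lemma enormE k (x : 'cV[R]_k) : enorm x = Num.sqrt (sqnorm x).
Proof. by []. Qed.

Lemma enorm_ge0 k (x : 'cV[R]_k) : 0 <= enorm x.
Proof. exact: sqrtr_ge0. Qed.

Lemma sqr_enorm k (x : 'cV[R]_k) : enorm x ^+ 2 = sqnorm x.
Proof. by rewrite sqr_sqrtr// sqnorm_ge0. Qed.

Lemma enormZ k c (x : 'cV[R]_k) : enorm (c *: x) = `|c| * enorm x.
Proof. by rewrite !enormE sqnormZ sqrtrM ?sqr_ge0// sqrtr_sqr. Qed.

Lemma enormN k (x : 'cV[R]_k) : enorm (- x) = enorm x.
Proof. by rewrite !enormE sqnormN. Qed.

Lemma ler_enormD k (x y : 'cV[R]_k) : enorm (x + y) <= enorm x + enorm y.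
Proof.
rewrite -(ler_pXn2r (n := 2)) ?nnegrE ?addr_ge0 ?enorm_ge0//.
rewrite sqrrD !sqr_enorm sqnormD lerD2r lerD2l.
rewrite -[enorm x * enorm y *+ 2]mulr_natl ler_pM2l//.
have h : dot x y ^+ 2 <= (enorm x * enorm y) ^+ 2.
  by rewrite exprMn !sqr_enorm cauchy_schwarz.
by apply: ler_normlW; rewrite -(ler_pXn2r (n := 2)) ?nnegrE ?mulr_ge0 ?enorm_ge0// real_normK ?num_real.
Qed.

Lemma ler_enormB k (x y : 'cV[R]_k) : enorm x - enorm y <= enorm (x - y).
Proof. by rewrite lerBlDr (le_trans _ (ler_enormD _ _))// subrK. Qed.

Lemma enorm0 k : enorm (0 : 'cV[R]_k) = 0.
Proof. by rewrite enormE (_ : sqnorm 0 = 0) ?sqrtr0//; apply/eqP; rewrite sqnorm_eq0. Qed.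

Lemma enorm_eq0 k (x : 'cV[R]_k) : (enorm x == 0) = (x == 0).
Proof. by rewrite -sqnorm_eq0 -sqr_enorm sqrf_eq0. Qed.

(** Gram-Schmidt on the rows, from the last to the first. A row with zero residual is dropped, so
    [Q] is orthonormal even if the rows of [U] are dependent. *)
Lemma schmidt (k n : nat) (U : 'M[R]_(k, n)) :
  exists r (Q : 'M[R]_(r, n)), Q *m Q^T = 1%:M /\ (Q == U)%MS.
Proof.
elim: k U => [|k ih]; last rewrite -[k.+1]/(1 + k)%N; move=> U.
  exists 0%N, 0; split; first by apply/matrixP => -[].
  by rewrite (flatmx0 U) submx_refl.
have [r [Q [QQ /eqmxP eQ]]] := ih (dsubmx U).
pose u := usubmx U.
pose v := u - u *m Q^T *m Q.
have vQ : v *m Q^T = 0 by rewrite mulmxBl -[_ *m Q *m _]mulmxA QQ mulmx1 subrr.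
have := submx_refl U.
rewrite -{1}[U]vsubmxK col_mx_sub -/u => /andP[uU dU].
have QU : (Q <= U)%MS by rewrite eQ.
have UQ m' (Q' : 'M[R]_(m', n)) : (u <= Q')%MS -> (Q <= Q')%MS -> (U <= Q')%MS.
  move=> uQ' QQ'; rewrite -[U]vsubmxK col_mx_sub uQ'/=.
  by rewrite -eQ.
have [v0|v0] := eqVneq v 0.
  exists r, Q; split=> //; rewrite QU/=; apply: UQ => //.
  by apply/submxP; exists (u *m Q^T); apply/eqP; rewrite -subr_eq0 -/v v0.
pose c := sqnorm v^T.
have c0 : 0 < c.
  rewrite lt0r sqnorm_ge0 andbT sqnorm_eq0; apply: contra v0 => /eqP vt.
  by rewrite -[v]trmxK vt trmx0.
have vv : v *m v^T = c%:M.
  apply/matrixP => i j; rewrite !ord1 !mxE eqxx mulr1n.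
  by apply: eq_bigr => l _; rewrite !mxE expr2.
pose s := (Num.sqrt c)^-1.
have s2 : s * s * c = 1.
  by rewrite -expr2 exprVn sqr_sqrtr ?ltW// mulVf// gt_eqF.
exists (1 + r)%N, (col_mx (s *: v) Q); split.
  rewrite tr_col_mx mul_col_row QQ linearZ/= -scalemxAl -!scalemxAr.
  rewrite -scalemxAl vQ vv !scaler0 scalerA.
  have -> : Q *m v^T = 0 by rewrite -[LHS]trmxK trmx_mul trmxK vQ trmx0.
  by rewrite scaler0 scale_scalar_mx s2 -scalar_mx_block.
rewrite col_mx_sub QU andbT; apply/andP; split.
  apply: scalemx_sub; apply: addmx_sub => //.
  by rewrite eqmx_opp (submx_trans (submxMl _ _)).
have := submx_refl (col_mx (s *: v) Q); rewrite col_mx_sub => /andP[h1 h2].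
apply: UQ => //; rewrite -[u](subrK (u *m Q^T *m Q)) -/v.
apply: addmx_sub; last exact: submx_trans (submxMl _ _) h2.
have sv : s^-1 *: (s *: v) = v.
  by rewrite scalerA mulVf ?scale1r// invr_eq0 gt_eqF// sqrtr_gt0.
by have := scalemx_sub s^-1 h1; rewrite sv.
Qed.

(** Orthonormal rows are free, which identifies their number with the rank. The sphere of the range
    thereby becomes the unit sphere in dimension [\rank W]. *)
Lemma orthonormal_range (p k : nat) (W : 'M[R]_(p, k)) :
  exists Q : 'M[R]_(p, \rank W), Q^T *m Q = 1%:M /\ mxrange Q = mxrange W.
Proof.
have [r [Q [QQ /eqmxP eQ]]] := schmidt W^T.
have rE : r = \rank W.
  rewrite -mxrank_tr -eQ; apply/esym/eqP; rewrite -/(row_free Q).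
  by apply/row_freeP; exists Q^T.
move: rE Q QQ eQ => -> Q QQ eQ; exists Q^T; rewrite trmxK; split => //.
have sub p' k1 k2 (C : 'M[R]_(p', k1)) (D : 'M[R]_(p', k2)) :
    (C^T <= D^T)%MS -> mxrange C `<=` mxrange D.
  move=> /submxP[X CX] _ [z _ <-]; exists (X^T *m z) => //.
  by rewrite mulmxA -[C]trmxK CX trmx_mul trmxK.
by apply/seteqP; split; apply: sub; rewrite trmxK eQ.
Qed.

End euclid.

(** * A net of small cardinality *)

Section grid.
Context {R : realType}.

(** An integer of absolute value at most [L]: zero is [None], and the index [i] stands for [i.+1],
    so every integer has exactly one code. *)
Local Notation digit L := (option (bool * 'I_L)).

Definition digit_abs {L} (a : digit L) : nat :=
  if a is Some (_, i) then i.+1 else 0.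

Definition digit_val {L} (a : digit L) : R :=
  if a is Some (b, i) then (-1) ^+ b * i.+1%:R else 0.

(** Truncating the absolute value plus one half rounds to a nearest integer. The second bound
    controls the l1-norm of the grid points. *)
Lemma digit_round (L : nat) (z : R) : `|z| + 1 / 2 < L%:R + 1 ->
  exists a : digit L, `|z - digit_val a| <= 1 / 2 /\
    (digit_abs a)%:R <= `|z| + 1 / 2.
Proof.
move=> zL; have z0 : 0 <= `|z| + 1 / 2 by rewrite addr_ge0// normr_ge0.
have /andP[] := truncn_itv z0.
set q := Num.truncn _ => q1 q2.
have qL : (q <= L)%N.
  by rewrite -ltnS -(ltr_nat R) (le_lt_trans q1)// -[ltRHS]natr1.
case: q q1 q2 qL => [|q] q1 q2 qL.
  by exists None; rewrite /= subr0; split; lra.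
exists (Some (z < 0, Ordinal qL)); split => //=.
move: q1 q2; rewrite -[q.+2%:R]natr1; case: (ltrP z 0) => z00 q1 q2.
  rewrite ltr0_norm// in q1 q2; rewrite expr1 mulN1r opprK ler_norml.
  by apply/andP; split; lra.
rewrite ger0_norm// in q1 q2; rewrite expr0 mul1r ler_norml.
by apply/andP; split; lra.
Qed.

(** A geometric series for each of the two signs: [1 + 2 * x / (1 - x) = (1 + x) / (1 - x)]. *)
Lemma sum_digit (L : nat) (x : R) : 0 <= x < 1 ->
  \sum_(a : digit L) x ^+ digit_abs a <= (1 + x) / (1 - x).
Proof.
move=> /andP[x0 x1]; have x1' : 0 < 1 - x by rewrite subr_gt0.
rewrite (bigD1 None)//= expr0 (reindex_omap Some id)/=; last by case.
rewrite (eq_bigl xpredT) => [|a]; last by rewrite !eqxx.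
rewrite (eq_bigr (fun p : bool * 'I_L => x ^+ p.2.+1)) => [|[b i]]//.
rewrite -(pair_bigA _ (fun (b : bool) (i : 'I_L) => x ^+ i.+1))/= big_bool/=.
have geo : \sum_(i < L) x ^+ i.+1 <= x / (1 - x).
  rewrite ler_pdivlMr//.
  have -> : (\sum_(i < L) x ^+ i.+1) * (1 - x) = x - x ^+ L.+1.
    elim: L => [|L ih]; first by rewrite big_ord0 mul0r expr1 subrr.
    by rewrite big_ord_recr/= mulrDl ih !exprS; ring.
  by rewrite lerBlDr lerDl exprn_ge0.
have -> : (1 + x) / (1 - x) = 1 + (x / (1 - x) + x / (1 - x)).
  by field; rewrite gt_eqF.
by rewrite lerD2l lerD.
Qed.

(** Each counted [k] contributes at least [x ^+ M] to the product of [r] copies of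
    the generating function of [digit_abs]. *)
Lemma count_digits (r L M : nat) (x : R) : 0 <= x < 1 ->
  #|[set k : {ffun 'I_r -> digit L} | (\sum_j digit_abs (k j) <= M)%N]%SET|%:R
    * x ^+ M <= ((1 + x) / (1 - x)) ^+ r.
Proof.
move=> x01; have /andP[x0 x1] := x01.
set K := [set k | _]%SET.
apply: (@le_trans _ _ ((\sum_(a : digit L) x ^+ digit_abs a) ^+ r)); last first.
  have S0 : 0 <= \sum_(a : digit L) x ^+ digit_abs a.
    by apply: sumr_ge0 => a _; rewrite exprn_ge0.
  have S1 := sum_digit L x01.
  by apply: lerXn2r; rewrite // nnegrE (le_trans S0).
rewrite -[r in leRHS]card_ord -prodr_const bigA_distr_bigA/=.
rewrite (bigID (fun k => k \in K))/= -[leLHS]addr0 lerD//; last first.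
  by apply: sumr_ge0 => k _; apply: prodr_ge0 => j _; rewrite exprn_ge0.
rewrite mulr_natl -sumr_const; apply: ler_sum => k; rewrite inE => kM.
rewrite -expr_sum; apply: ler_wiXn2l => //; exact: ltW.
Qed.

(** The constant is the quotient of [12] by the [13 / 3] of the grid count. Squaring a Taylor bound
    at [1 / 2] is sharp enough. *)
Lemma expR1_le : expR 1 <= 36 / 13 :> R.
Proof.
have h : 29 / 48 <= expR (- (1 / 2)) :> R.
  by apply: le_trans (expRN_ge_cubic _); lra.
have h2 : 13 / 36 <= expR (- (1 / 2)) * expR (- (1 / 2)) :> R.
  apply: (@le_trans _ _ (29 / 48 * (29 / 48))); first lra.
  by apply: ler_pM => //; lra.
have e1 : expR (- (1 / 2)) * expR (- (1 / 2)) = (expR 1)^-1 :> R.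
  by rewrite -expRD -expRN; congr expR; field.
rewrite e1 in h2.
by rewrite -[leLHS]invrK -[36 / 13]invf_div lef_pV2 ?posrE ?invr_gt0 ?expR_gt0//.
Qed.

(** Round the points of the sphere to the grid of step [h = 2 (eps / 3) / sqrt r].
    The grid points met have l1-norm at most [h * rad], and [count_digits] with
    [x = exp(- 2 eps / (3 + eps))], for which [x ^ rad = exp(- r)], bounds their
    number by [(13 / (3 eps))^r * exp(r) <= (12 / eps)^r]. *)
Lemma grid_net (r : nat) (eps : R) : 0 < eps < 1 ->
  exists s : seq 'cV[R]_r, (size s)%:R <= (12 / eps) ^+ r /\
    forall y, sqnorm y = 1 ->
      exists2 p, p \in s & sqnorm (y - p) <= (eps / 3) ^+ 2.
Proof.
move=> /andP[e0 e1]; case: r => [|r].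
  exists [::]; split; first by rewrite expr0.
  by move=> y; rewrite /sqnorm big_ord0 => /eqP; rewrite eq_sym oner_eq0.
set n := r.+1; have n0 : 0 < n%:R :> R by rewrite ltr0n.
(* Rounding errs by at most [h / 2] per coordinate, and [n * (h / 2) ^ 2] is the allowed squared
   error. *)
pose h : R := 2 * (eps / 3) / Num.sqrt n%:R.
have h0 : 0 < h by rewrite divr_gt0 ?sqrtr_gt0// mulr_gt0// divr_gt0.
have h2 : n%:R * h ^+ 2 / 4 = (eps / 3) ^+ 2.
  by rewrite /h expr_div_n sqr_sqrtr ?ltW//; field; rewrite gt_eqF.
(* As [(1 + x) / (1 - x)] is about [1 / a], the count is about [exp (2 * a * rad) / a ^ n], which is
   least where [2 * a * rad = n]. *)
pose a := eps / (3 + eps).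
have a0 : 0 < a by rewrite divr_gt0// addr_gt0.
have a1 : a < 1 by rewrite ltr_pdivrMr ?addr_gt0//; lra.
pose x := expR (- (2 * a)).
(* The l1-norm of a rounded point in units of [h]: at most [Num.sqrt n / h] from the point of the
   sphere and [n / 2] from the rounding. *)
pose rad := n%:R * ((3 + eps) / (2 * eps)).
have rad0 : 0 <= rad by rewrite mulr_ge0 ?ltW// divr_gt0 ?addr_gt0 ?mulr_gt0.
have arad : 2 * a * rad = n%:R by rewrite /a /rad; field; rewrite !gt_eqF// addr_gt0.
pose M := Num.truncn rad; pose L := Num.truncn (h^-1 + 1 / 2).
have hL : h^-1 + 1 / 2 < L%:R + 1.
  have /andP[_] := @truncn_itv R (h^-1 + 1 / 2) ltac:(by rewrite addr_ge0// invr_ge0 ltW).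
  by rewrite natr1.
have MM : M%:R <= rad by have /andP[] := @truncn_itv R rad rad0.
pose K := [set k : {ffun 'I_n -> digit L} | (\sum_j digit_abs (k j) <= M)%N]%SET.
exists [seq h *: \col_j digit_val (k j) | k : {ffun 'I_n -> digit L} <- enum K].
split.
  rewrite size_map -cardE.
  have x01 : 0 <= x < 1 by rewrite expR_ge0 expR_lt1 oppr_lt0 mulr_gt0.
  have cnt := count_digits n L M x01; rewrite -/K in cnt.
  have x1 : 0 < 1 - x by case/andP: x01; rewrite subr_gt0.
  have S1 : (1 + x) / (1 - x) <= 13 / 3 / eps.
    have xq : x <= 1 - 2 * a + 2 * a ^+ 2.
      have := @expRN_le_quadratic R (2 * a) ltac:(by rewrite mulr_ge0// ltW).
      by rewrite -/x; lra.
    rewrite ler_pdivrMr// mulrAC ler_pdivlMr// [leRHS]mulrC.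
    have : (1 - (1 - 2 * a + 2 * a ^+ 2)) * (13 / 3) <= (1 - x) * (13 / 3) by lra.
    apply: le_trans; apply: (@le_trans _ _ ((1 + (1 - 2 * a + 2 * a ^+ 2)) * eps)).
      by apply: ler_wpM2r; [exact: ltW|rewrite lerD2l].
    rewrite -subr_ge0 [X in 0 <= X](_ : _ =
      a * 2 * (13 / 3 * (1 - a) - eps * (a^-1 - 1 + a))); last by field; rewrite gt_eqF.
    apply: mulr_ge0; first by rewrite mulr_ge0// ltW.
    rewrite subr_ge0.
    (* The constant [13 / 3] is the value of [3 + eps + eps ^ 2 / 3] at [eps = 1]. *)
    rewrite [X in X <= _](_ : _ = (3 + eps + eps ^+ 2 / 3) * (1 - a)); last first.
      by rewrite /a; field; rewrite !gt_eqF// addr_gt0.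
    by apply: ler_wpM2r; [rewrite subr_ge0 ltW|nra].
  have Sx : 0 <= (1 + x) / (1 - x).
    by rewrite divr_ge0 ?ltW// addr_gt0 ?expR_gt0.
  have xM : (expR (- n%:R)) <= x ^+ M.
    rewrite /x -expRM_natl ler_expR mulrN lerN2 mulrC -arad.
    by rewrite ler_wpM2l// mulr_ge0// ltW.
  have : #|K|%:R * expR (- n%:R) <= (13 / 3 / eps) ^+ n.
    apply: (@le_trans _ _ (#|K|%:R * x ^+ M)); first by rewrite ler_wpM2l.
    apply: le_trans cnt _; apply: lerXn2r => //.
    by rewrite nnegrE (le_trans Sx).
  rewrite expRN -[X in expR X]mulr1 expRM_natl ler_pdivrMr ?exprn_gt0 ?expR_gt0//.
  move=> /le_trans; apply; rewrite -exprMn; apply: lerXn2r.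
  - by rewrite nnegrE mulr_ge0 ?expR_ge0// (le_trans Sx).
  - by rewrite nnegrE divr_ge0// ltW.
  - rewrite (_ : 12 / eps = 13 / 3 / eps * (36 / 13)); last by field; rewrite gt_eqF.
    by rewrite ler_wpM2l ?expR1_le// (le_trans Sx).
move=> y y1.
have yj1 j : `|y j 0| <= 1.
  rewrite -(ler_pXn2r (n := 2)) ?nnegrE ?normr_ge0// expr1n real_normK ?num_real//.
  by rewrite -y1 /sqnorm (bigD1 j)//= lerDl sumr_ge0// => i _; exact: sqr_ge0.
have /choice[k kP] : forall j, exists b : digit L,
    `|y j 0 / h - digit_val b| <= 1 / 2 /\
    (digit_abs b)%:R <= `|y j 0 / h| + 1 / 2.
  move=> j; apply: digit_round; apply: le_lt_trans hL; rewrite lerD2r.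
  by rewrite normrM normfV (gtr0_norm h0) ler_piMl// invr_ge0 ltW.
exists (h *: \col_j digit_val (k j)).
  apply/mapP; exists [ffun j => k j]; last first.
    by congr (_ *: _); apply/colP => j; rewrite !mxE ffunE.
  rewrite mem_enum inE -(ler_nat R); under eq_bigr do rewrite ffunE.
  have : (\sum_j digit_abs (k j))%:R <= rad.
    rewrite natr_sum; apply: (@le_trans _ _ (\sum_(j < n) (`|y j 0 / h| + 1 / 2))).
      by apply: ler_sum => j _; case: (kP j).
    rewrite big_split/= sumr_const card_ord.
    have -> : \sum_(j < n) `|y j 0 / h| = (\sum_(j < n) `|y j 0|) / h.
      by rewrite mulr_suml; apply: eq_bigr => j _; rewrite normrM normfV (gtr0_norm h0).
    have s1 : \sum_(j < n) `|y j 0| <= Num.sqrt n%:R.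
      have := cauchy_schwarz (\col_j `|y j 0|) (const_mx 1 : 'cV[R]_n).
      have -> : sqnorm (\col_j `|y j 0|) = 1.
        by rewrite -y1; apply: eq_bigr => j _; rewrite mxE real_normK ?num_real.
      have -> : sqnorm (const_mx 1 : 'cV[R]_n) = n%:R.
        rewrite /sqnorm; under eq_bigr do rewrite mxE expr1n.
        by rewrite sumr_const card_ord.
      rewrite mul1r /dot; under eq_bigr do rewrite !mxE mulr1.
      move=> hh; rewrite -(ler_pXn2r (n := 2)) ?nnegrE ?sqrtr_ge0 ?sumr_ge0//.
      by rewrite sqr_sqrtr// ltW.
    apply: (@le_trans _ _ (Num.sqrt n%:R / h + 1 / 2 *+ n)).
      by rewrite lerD2r ler_pM2r ?invr_gt0.
    have -> : Num.sqrt n%:R / h = n%:R * (3 / (2 * eps)).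
      have q0 : Num.sqrt n%:R != 0 :> R by rewrite gt_eqF// sqrtr_gt0.
      rewrite /h -[n%:R in RHS]sqr_sqrtr ?ltW//; move: q0.
      by move: (Num.sqrt _) => q q0; field; rewrite q0 gt_eqF.
    by rewrite -[_ *+ n]mulr_natl /rad le_eqVlt; apply/orP; left; apply/eqP; field; rewrite gt_eqF.
  by rewrite -truncn_ge_nat// ler_nat.
rewrite -h2 /sqnorm.
have -> : n%:R * h ^+ 2 / 4 = \sum_(j < n) h ^+ 2 / 4.
  by rewrite sumr_const card_ord -mulrA mulr_natl.
apply: ler_sum => j _; rewrite !mxE.
have -> : y j 0 - h * digit_val (k j) = h * (y j 0 / h - digit_val (k j)).
  by field; rewrite gt_eqF.
rewrite exprMn ler_wpM2l ?sqr_ge0// -real_normK ?num_real//.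
have [+ _] := kP j; move: `|_| (normr_ge0 (y j 0 / h - digit_val (k j))) => z z0 z1.
by nra.
Qed.

End grid.

(** * Restricted isometry and recovery *)

Section deterministic.
Context {R : realType}.

Lemma mxrangeB (p k : nat) (W : 'M[R]_(p, k)) x y :
  mxrange W x -> mxrange W y -> mxrange W (x - y).
Proof. by move=> [a _ <-] [b _ <-]; exists (a - b); rewrite ?mulmxBr. Qed.

Lemma mxrangeZ (p k : nat) (W : 'M[R]_(p, k)) c x :
  mxrange W x -> mxrange W (c *: x).
Proof. by move=> [a _ <-]; exists (c *: a); rewrite // -scalemxAr. Qed.

Lemma isometry_sqnorm (p r : nat) (Q : 'M[R]_(p, r)) y :
  Q^T *m Q = 1%:M -> sqnorm (Q *m y) = sqnorm y.
Proof.
move=> QQ; rewrite -!dotxx !dotE trmx_mul -mulmxA (mulmxA Q^T) QQ mul1mx //.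
Qed.

Lemma normalized (k : nat) (x : 'cV[R]_k) : x != 0 ->
  sqnorm ((enorm x)^-1 *: x) = 1.
Proof.
move=> x0; rewrite sqnormZ exprVn sqr_enorm mulVf// sqnorm_eq0//.
Qed.

(** For unit vectors, [1 - dot x v ^ 2] is the squared distance from [x] to the line spanned by [v].
    Measured this way, normalizing the grid points costs nothing and the mesh stays [eps / 3]. *)
Lemma range_net (p k : nat) (W : 'M[R]_(p, k)) (eps : R) : 0 < eps < 1 ->
  exists s : seq 'cV[R]_p, [/\ (size s)%:R <= (12 / eps) ^+ \rank W,
    forall v, v \in s -> sqnorm v = 1 /\ mxrange W v &
    forall x, mxrange W x -> sqnorm x = 1 ->
      exists2 v, v \in s & 1 - dot x v ^+ 2 <= (eps / 3) ^+ 2].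
Proof.
move=> eps01; have /andP[e0 e1] := eps01.
have [Q [QQ QW]] := orthonormal_range W.
have [s [sN sP]] := grid_net (\rank W) eps01.
(* Zero cannot be normalized; being at distance [1] from the sphere, it never serves as an
   approximation. *)
exists [seq (enorm (Q *m v))^-1 *: (Q *m v) | v <- s & v != 0]; split.
- rewrite size_map (le_trans _ sN)// ler_nat size_filter; exact: count_size.
- move=> _ /mapP[v + ->]; rewrite mem_filter => /andP[v0 _]; split.
    apply: normalized; apply: contra v0 => /eqP Qv.
    by rewrite -sqnorm_eq0 -(isometry_sqnorm _ QQ) Qv sqnorm_eq0.
  by apply: mxrangeZ; rewrite -QW; exists v.
- move=> x; rewrite -QW => -[y _ <-]; rewrite isometry_sqnorm// => y1.
  have [v vs yv] := sP _ y1.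
  have v0 : v != 0.
    apply/eqP => v0; move: yv; rewrite v0 subr0 y1; nra.
  exists ((enorm (Q *m v))^-1 *: (Q *m v)).
    by apply/mapP; exists v; rewrite // mem_filter v0.
  rewrite (le_trans _ yv)// dotZr exprMn exprVn sqr_enorm isometry_sqnorm//.
  have -> : dot (Q *m y) (Q *m v) = dot y v.
    by rewrite !dotE trmx_mul -mulmxA (mulmxA Q^T) QQ mul1mx.
  have vp : 0 < sqnorm v by rewrite lt0r sqnorm_eq0 v0 sqnorm_ge0.
  rewrite sqnormB y1 -subr_ge0.
  rewrite [X in 0 <= X](_ : _ = (sqnorm v - dot y v) ^+ 2 / sqnorm v).
    by rewrite divr_ge0 ?sqr_ge0// ltW.
  by field; rewrite gt_eqF.
Qed.

Lemma mulmx_bounded (m p : nat) (A : 'M[R]_(m, p)) :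
  exists2 F : R, 0 <= F & forall x, enorm (A *m x) <= F * enorm x.
Proof.
pose F2 := \sum_i sqnorm (row i A)^T.
have F20 : 0 <= F2 by apply: sumr_ge0 => i _; exact: sqnorm_ge0.
exists (Num.sqrt F2); first exact: sqrtr_ge0.
move=> x; rewrite -(ler_pXn2r (n := 2)) ?nnegrE ?mulr_ge0 ?enorm_ge0 ?sqrtr_ge0//.
rewrite exprMn !sqr_enorm sqr_sqrtr// /F2 mulr_suml; apply: ler_sum => i _.
apply: le_trans (cauchy_schwarz _ _); rewrite le_eqVlt; apply/orP; left.
apply/eqP; congr (_ ^+ 2); rewrite mxE; apply: eq_bigr => j _.
by rewrite !mxE.
Qed.

(** [b] is the norm of [A] on the range, for which the net gives the implicit bound. *)
Lemma rip_constants (eps b : R) : 0 < eps < 1 ->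
  0 <= b -> b <= Num.sqrt (1 + eps / 2) + eps / 3 * b ->
  1 - eps <= Num.sqrt (1 - (eps / 3) ^+ 2) * Num.sqrt (1 - eps / 2) - b * (eps / 3).
Proof.
move=> /andP[e0 e1] b0 hb.
have h1 : Num.sqrt (1 + eps / 2) <= 1 + eps / 4.
  rewrite -(ler_pXn2r (n := 2)) ?nnegrE ?sqrtr_ge0//; last by lra.
  by rewrite sqr_sqrtr; nra.
have h2 : 1 - 3 / 10 * eps <= Num.sqrt (1 - eps / 2).
  rewrite -(ler_pXn2r (n := 2)) ?nnegrE ?sqrtr_ge0//; last by lra.
  by rewrite sqr_sqrtr; nra.
have h3 : 1 - 6 / 100 * eps <= Num.sqrt (1 - (eps / 3) ^+ 2).
  rewrite -(ler_pXn2r (n := 2)) ?nnegrE ?sqrtr_ge0//; last by lra.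
  by rewrite sqr_sqrtr; nra.
(* The coefficient is exact at [eps = 1], where [(1 + 1 / 4) / (1 - 1 / 3) = 15 / 8]. *)
have bb : b <= 1 + 7 / 8 * eps.
  rewrite leNgt; apply/negP => hlt.
  have : b * (1 - eps / 3) <= 1 + eps / 4 by lra.
  have h : 0 < 1 - eps / 3 by lra.
  by rewrite leNgt; apply/negP; nra.
have h4 : (1 - 6 / 100 * eps) * (1 - 3 / 10 * eps) <=
    Num.sqrt (1 - (eps / 3) ^+ 2) * Num.sqrt (1 - eps / 2).
  by apply: ler_pM => //; lra.
have h5 : b * (eps / 3) <= (1 + 7 / 8 * eps) * (eps / 3).
  by rewrite ler_wpM2r//; lra.
move: h4 h5; move: (_ * Num.sqrt _) (b * _) => u v h4 h5; nra.
Qed.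

(** Let [B] be the norm of [A] on the range. Splitting a unit vector along a net vector bounds [B]
    in terms of itself; the same splitting with the reverse triangle inequality then gives the lower
    bound. *)
Lemma net_rip (m p k : nat) (A : 'M[R]_(m, p)) (W : 'M[R]_(p, k)) (eps : R)
    (s : seq 'cV[R]_p) : 0 < eps < 1 ->
  (forall v, v \in s -> sqnorm v = 1 /\ mxrange W v) ->
  (forall x, mxrange W x -> sqnorm x = 1 ->
     exists2 v, v \in s & 1 - dot x v ^+ 2 <= (eps / 3) ^+ 2) ->
  (forall v, v \in s -> 1 - eps / 2 <= sqnorm (A *m v) <= 1 + eps / 2) ->
  forall x, mxrange W x -> (1 - eps) * enorm x <= enorm (A *m x).
Proof.
move=> eps01 sW sP sA; have /andP[e0 e1] := eps01.
suff unit_case x : mxrange W x -> sqnorm x = 1 -> 1 - eps <= enorm (A *m x).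
  move=> x Wx; have [->|x0] := eqVneq x 0; first by rewrite mulmx0 !enorm0 mulr0.
  have := unit_case _ (mxrangeZ (enorm x)^-1 Wx) (normalized x0).
  rewrite -scalemxAr enormZ ger0_norm ?invr_ge0 ?enorm_ge0// mulrC.
  by rewrite ler_pdivlMr// lt0r enorm_eq0 x0 enorm_ge0.
move=> Wx x1.
pose S := [set enorm (A *m y) | y in [set y | mxrange W y /\ sqnorm y = 1]].
have [F F0 AF] := mulmx_bounded A.
have enorm1 (y : 'cV[R]_p) : sqnorm y = 1 -> enorm y = 1.
  by move=> y1; rewrite enormE y1 sqrtr1.
have ubS : ubound S F.
  by move=> _ [y [_ y1] <-]; rewrite (le_trans (AF y))// enorm1// mulr1.
have supS : has_sup S.
  by split; [exists (enorm (A *m x)), x|exists F].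
pose B := sup S.
have B0 : 0 <= B.
  apply: (le_trans (enorm_ge0 (A *m x))); apply: sup_upper_bound => //.
  by exists x.
have AB y : mxrange W y -> enorm (A *m y) <= B * enorm y.
  move=> Wy; have [->|y0] := eqVneq y 0; first by rewrite mulmx0 !enorm0 mulr0.
  have yp : 0 < enorm y by rewrite lt0r enorm_eq0 y0 enorm_ge0.
  rewrite -ler_pdivrMr// mulrC -[_^-1]ger0_norm ?invr_ge0 ?enorm_ge0//.
  rewrite -enormZ scalemxAr; apply: sup_upper_bound => //.
  by exists ((enorm y)^-1 *: y) => //; split; [exact: mxrangeZ|exact: normalized].
(* The remainder [y - c *: v] is orthogonal to [v], has squared norm [1 - c ^ 2], and stays in the
   range, so [B] applies to it. *)
have split_y y : mxrange W y -> sqnorm y = 1 -> exists c v, [/\ v \in s,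
    Num.sqrt (1 - (eps / 3) ^+ 2) <= `|c|, `|c| <= 1 &
    enorm (A *m (y - c *: v)) <= B * (eps / 3)].
  move=> Wy y1; have [v vs yv] := sP y Wy y1; have [v1 Wv] := sW v vs.
  exists (dot y v), v; split => //.
  - rewrite -[leRHS]ger0_norm ?normr_ge0// -sqrtr_sqr ler_wsqrtr//.
    by rewrite real_normK ?num_real//; lra.
  - rewrite -(ler_pXn2r (n := 2)) ?nnegrE ?normr_ge0// expr1n real_normK ?num_real//.
    by have := cauchy_schwarz y v; rewrite y1 v1 mulr1.
  - apply: le_trans (AB _ (mxrangeB Wy (mxrangeZ _ Wv))) _; rewrite ler_wpM2l//.
    rewrite -(ler_pXn2r (n := 2)) ?nnegrE ?enorm_ge0 ?divr_ge0 ?(ltW e0)//.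
    rewrite sqr_enorm sqnormB sqnormZ dotZr v1 y1 (le_trans _ yv)//.
    by rewrite le_eqVlt; apply/orP; left; apply/eqP; ring.
have Av v : v \in s -> Num.sqrt (1 - eps / 2) <= enorm (A *m v) <=
    Num.sqrt (1 + eps / 2).
  by move=> /sA /andP[h1 h2]; rewrite enormE !ler_wsqrtr.
have Bb : B <= Num.sqrt (1 + eps / 2) + eps / 3 * B.
  apply: ge_sup => [|_ [y [Wy y1] <-]]; first by case: supS.
  have [c [v [vs c0 c1 yv]]] := split_y y Wy y1.
  rewrite -[y](subrK (c *: v)) [_ + c *: v]addrC mulmxDr (le_trans (ler_enormD _ _))//.
  rewrite [eps / 3 * B]mulrC lerD// -scalemxAr enormZ.
  have /andP[_ h] := Av v vs.
  by rewrite (le_trans _ h)// ler_piMl// enorm_ge0.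
have [c [v [vs c0 c1 xv]]] := split_y x Wx x1.
apply: le_trans (rip_constants eps01 B0 Bb) _.
rewrite -[x in leRHS](subrK (c *: v)) [_ + c *: v]addrC mulmxDr.
rewrite -[A *m (x - _)]opprK (le_trans _ (ler_enormB _ _))// enormN lerB//.
rewrite -scalemxAr enormZ; apply: ler_pM => //; rewrite ?sqrtr_ge0//.
by have /andP[] := Av v vs.
Qed.

Lemma ratr_approx (k : nat) (y : 'cV[R]_k) (e : R) : 0 < e ->
  exists q : 'cV[rat]_k, enorm (y - map_mx ratr q) <= e.
Proof.
(* The successor keeps [h] positive in dimension zero. *)
move=> e0; pose h := e / Num.sqrt k.+1%:R.
have k0 : 0 < k.+1%:R :> R by rewrite ltr0n.
have h0 : 0 < h by rewrite divr_gt0// sqrtr_gt0.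
have /choice[q qP] : forall i, exists a : rat, y i 0 - h < ratr a < y i 0.
  move=> i; have [a] := @rat_in_itvoo R (y i 0 - h) (y i 0) ltac:(by rewrite ltrBlDr ltrDl).
  by rewrite in_itv/= => ha; exists a.
exists (\col_i q i).
rewrite -(ler_pXn2r (n := 2)) ?nnegrE ?enorm_ge0 ?(ltW e0)// sqr_enorm.
have -> : e ^+ 2 = k.+1%:R * h ^+ 2.
  by rewrite /h expr_div_n sqr_sqrtr ?(ltW k0)// mulrC divfK// gt_eqF.
apply: (@le_trans _ _ (\sum_(i < k) h ^+ 2)); last first.
  by rewrite sumr_const card_ord -[h ^+ 2 *+ k]mulr_natl ler_wpM2r ?sqr_ge0// ler_nat.
apply: ler_sum => i _; rewrite !mxE.
have /andP[h1 h2] := qP i.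
by rewrite ler_pXn2r ?nnegrE ?subr_ge0 ?(ltW h0) ?(ltW h2)//; lra.
Qed.

(** Rational coefficients turn the good event into a countable combination of
    measurable sets; [near_proj_ratr] says that some point of the range, nearly
    closest to [xi], has [enorm (A *m (xi - v))] at most twice the distance. *)
Definition rip_ratr (m p k : nat) (A : 'M[R]_(m, p)) (W : 'M[R]_(p, k)) (eps : R) :=
  forall q : 'cV[rat]_k,
    (1 - eps) * enorm (W *m map_mx ratr q) <= enorm (A *m (W *m map_mx ratr q)).

Definition near_proj_ratr (m p k : nat) (A : 'M[R]_(m, p)) (W : 'M[R]_(p, k))
    (xi : 'cV[R]_p) :=
  forall N : nat, exists q : 'cV[rat]_k, forall q' : 'cV[rat]_k,
    enorm (xi - W *m map_mx ratr q) <=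
      enorm (xi - W *m map_mx ratr q') + N.+1%:R^-1 /\
    enorm (A *m (xi - W *m map_mx ratr q)) <=
      2 * enorm (xi - W *m map_mx ratr q') + N.+1%:R^-1.

Lemma range_approx (p k : nat) (W : 'M[R]_(p, k)) v (e : R) : 0 < e ->
  mxrange W v -> exists q : 'cV[rat]_k, enorm (v - W *m map_mx ratr q) <= e.
Proof.
move=> e0 [y _ <-]; have [F F0 WF] := mulmx_bounded W.
have F1 : 0 < F + 1 by rewrite ltr_wpDl.
have [q hq] := ratr_approx y (divr_gt0 e0 F1); exists q.
rewrite -mulmxBr (le_trans (WF _))//.
apply: (@le_trans _ _ (F * (e / (F + 1)))); first by rewrite ler_wpM2l.
by rewrite mulrCA ler_piMr ?(ltW e0)// ler_pdivrMr// mul1r lerDl.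
Qed.

Lemma mulmx_enormB (m p : nat) (A : 'M[R]_(m, p)) (F : R) :
  (forall x, enorm (A *m x) <= F * enorm x) ->
  forall x y, enorm (A *m x) <= enorm (A *m y) + F * enorm (x - y).
Proof.
move=> AF x y; rewrite -{1}[x](subrK y) mulmxDr addrC (le_trans (ler_enormD _ _))//.
by rewrite lerD2l.
Qed.

Lemma rip_ratr_range (m p k : nat) (A : 'M[R]_(m, p)) (W : 'M[R]_(p, k)) (eps : R) :
  0 < eps < 1 -> rip_ratr A W eps ->
  forall v, mxrange W v -> (1 - eps) * enorm v <= enorm (A *m v).
Proof.
move=> /andP[e0 e1] AW v Wv; have [F F0 AF] := mulmx_bounded A.
apply/ler_addgt0Pr => e e'0; have F1 : 0 < F + 1 by rewrite ltr_wpDl.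
have [q hq] := range_approx (divr_gt0 e'0 F1) Wv.
set v' := W *m _ in hq.
have h1 : enorm v <= enorm v' + enorm (v - v').
  by have := ler_enormD v' (v - v'); rewrite addrC subrK addrC.
have h2 := mulmx_enormB AF v' v.
have h3 : enorm (v' - v) = enorm (v - v') by rewrite -enormN opprB.
have h4 := AW q; rewrite -/v' in h4; rewrite h3 in h2.
have h5 : (F + 1) * enorm (v - v') <= e by rewrite mulrC -ler_pdivlMr.
have h6 := enorm_ge0 (v - v').
by nra.
Qed.

Lemma recovery_bound (m p : nat) (A : 'M[R]_(m, p)) (W : 'M[R]_p)
    (xi : 'cV[R]_p) (eta : 'cV[R]_m) (delta eps : R) :
  0 < eps < 1 -> 0 <= delta -> rip_ratr A W eps -> near_proj_ratr A W xi ->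
  forall x, feasible A W (A *m xi + eta) delta x ->
  enorm (x - xi) <= (1 + 2 / (1 - eps)) * dist_to xi (mxrange W) +
    (delta + enorm eta) / (1 - eps).
Proof.
move=> eps01 d0 /(rip_ratr_range eps01) rip near x [xd Wx].
have /andP[e0 e1] := eps01; have e1' : 0 < 1 - eps by rewrite subr_gt0.
have xd' : enorm (A *m x - (A *m xi + eta)) <= delta.
  by rewrite -(ler_pXn2r (n := 2)) ?nnegrE ?enorm_ge0.
set D := dist_to _ _.
have W0 : [set enorm (xi - y) | y in mxrange W] !=set0.
  by exists (enorm (xi - x)), x.
(* A bound against all rational combinations passes to the infimum over the range, by density. *)
have D_near (c k : R) (z : R) : 0 < c ->
    (forall q : 'cV[rat]_p, z <= c * enorm (xi - W *m map_mx ratr q) + k) ->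
    z <= c * D + k.
  move=> c0 h; rewrite -lerBlDr mulrC -ler_pdivrMr//.
  apply: lb_le_inf => // _ [y Wy <-]; rewrite ler_pdivrMr// lerBlDr mulrC.
  apply/ler_addgt0Pr => e e'0.
  have [q hq] := range_approx (divr_gt0 e'0 c0) Wy.
  apply: le_trans (h q) _; rewrite addrAC lerD2r.
  have : enorm (xi - W *m map_mx ratr q) <= enorm (xi - y) + enorm (y - W *m map_mx ratr q).
    by have := ler_enormD (xi - y) (y - W *m map_mx ratr q); rewrite addrA subrK.
  rewrite ler_pdivlMr// in hq => h'.
  by have := ler_wpM2l (ltW c0) h'; rewrite mulrDr => h''; lra.
apply/ler_addgt0Pr => e e'0.
(* The slack of the nearly closest point enters twice, once directly and once divided by
   [1 - eps]. *)
pose K := 1 + (1 - eps)^-1; have K0 : 0 < K by rewrite addr_gt0// invr_gt0.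
have eK : 0 < e / K by rewrite divr_gt0.
pose N := Num.truncn (e / K)^-1.
have NK : N.+1%:R^-1 <= e / K.
  rewrite -[leRHS]invrK lef_pV2 ?posrE ?ltr0n ?invr_gt0//.
  have /andP[_ /ltW] := @truncn_itv R (e / K)^-1 ltac:(by rewrite invr_ge0 ltW).
  by [].
have [q hq] := near N; set v' := W *m map_mx ratr q in hq.
have Wv' : mxrange W v' by exists (map_mx ratr q).
have h1 : enorm (xi - v') <= D + e / K.
  rewrite -[D]mul1r; apply: D_near => // q'; rewrite mul1r.
  by have [h _] := hq q'; rewrite (le_trans h)// lerD2l.
have h2 : enorm (A *m (xi - v')) <= 2 * D + e / K.
  apply: D_near => // q'; have [_ h] := hq q'.
  by rewrite (le_trans h)// lerD2l.
have h3 := rip _ (mxrangeB Wx Wv').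
have h4 : enorm (A *m (x - v')) <=
    enorm (A *m x - (A *m xi + eta)) + (enorm eta + enorm (A *m (xi - v'))).
  have -> : A *m (x - v') = (A *m x - (A *m xi + eta)) + (eta + A *m (xi - v')).
    by rewrite !mulmxBr opprD !addrA subrK [_ - _ + _]addrAC addrK.
  by rewrite (le_trans (ler_enormD _ _))// lerD2l ler_enormD.
have h5 : enorm (x - xi) <= enorm (x - v') + enorm (xi - v').
  have -> : x - xi = (x - v') + (v' - xi) by rewrite addrA subrK.
  by rewrite -[enorm (xi - v')]enormN opprB ler_enormD.
have h6 : enorm (x - v') <= (delta + enorm eta + (2 * D + e / K)) / (1 - eps).
  by rewrite ler_pdivlMr// mulrC; lra.
apply: le_trans h5 _; apply: le_trans (lerD h6 h1) _.
rewrite le_eqVlt; apply/orP; left; apply/eqP.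
have ek : e = e / K * (1 + (1 - eps)^-1) by rewrite divfK// gt_eqF.
rewrite [in RHS]ek; move: (e / K) (1 - eps)^-1 => a g; ring.
Qed.

Lemma range_proj (p k : nat) (W : 'M[R]_(p, k)) (xi : 'cV[R]_p) :
  exists2 v, mxrange W v &
    forall y, mxrange W y -> enorm (xi - v) <= enorm (xi - y).
Proof.
have [Q [QQ <-]] := orthonormal_range W.
exists (Q *m (Q^T *m xi)); first by exists (Q^T *m xi).
move=> _ [z _ <-]; rewrite !enormE ler_wsqrtr//.
have -> : xi - Q *m z = (xi - Q *m (Q^T *m xi)) + Q *m (Q^T *m xi - z).
  by rewrite mulmxBr addrA subrK.
have orth : dot (xi - Q *m (Q^T *m xi)) (Q *m (Q^T *m xi - z)) = 0.
  have oQ : (xi - Q *m (Q^T *m xi))^T *m Q = 0.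
    by rewrite raddfB/= !trmx_mul trmxK mulmxBl -!mulmxA QQ mulmx1 subrr.
  by rewrite dotE mulmxA oQ mul0mx mxE.
by rewrite [leRHS]sqnormD orth mulr0 addr0 lerDl sqnorm_ge0.
Qed.

(** The list is fixed before [A], as a union bound requires. The factor [2] pays for the normalized
    residual, since [(12 / eps) ^ \rank W] is at least [1]; a zero residual adds no vector. *)
Lemma test_vectors (p k : nat) (W : 'M[R]_(p, k)) (xi : 'cV[R]_p) (eps : R) :
  0 < eps < 1 ->
  exists s : seq 'cV[R]_p, [/\ (size s)%:R <= 2 * (12 / eps) ^+ \rank W,
    forall v, v \in s -> sqnorm v = 1 &
    forall m (A : 'M[R]_(m, p)),
      (forall v, v \in s -> 1 - eps / 2 <= sqnorm (A *m v) <= 1 + eps / 2) ->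
      rip_ratr A W eps /\ near_proj_ratr A W xi].
Proof.
move=> eps01; have /andP[e0 e1] := eps01.
have [s [sN sW sP]] := range_net W eps01.
have [v0 Wv0 v0P] := range_proj W xi.
pose u := xi - v0.
exists (if u == 0 then s else (enorm u)^-1 *: u :: s); split.
- have N1 : 1 <= (12 / eps) ^+ \rank W.
    by rewrite exprn_ege1// ler_pdivlMr//; lra.
  case: ifP => _ /=; first by lra.
  by rewrite -natr1; lra.
- move=> v; case: ifPn => [_ /sW[]//|u0].
  by rewrite inE => /predU1P[->|/sW[]//]; exact: normalized.
move=> m A hA; split.
  move=> q; apply: (net_rip eps01 sW sP); last by exists (map_mx ratr q).
  by move=> v vs; apply: hA; case: ifP => _ //; rewrite inE vs orbT.
have Au : enorm (A *m u) <= 2 * enorm u.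
  have [->|u0] := eqVneq u 0; first by rewrite mulmx0 !enorm0 mulr0.
  have up : 0 < enorm u by rewrite lt0r enorm_eq0 u0 enorm_ge0.
  have /andP[_] : 1 - eps / 2 <= sqnorm (A *m ((enorm u)^-1 *: u)) <= 1 + eps / 2.
    by apply: hA; rewrite (negbTE u0) inE eqxx.
  rewrite -scalemxAr sqnormZ exprVn mulrC ler_pdivrMr ?exprn_gt0// => h.
  rewrite -(ler_pXn2r (n := 2)) ?nnegrE ?enorm_ge0 ?mulr_ge0 ?enorm_ge0//.
  rewrite exprMn sqr_enorm (le_trans h)// ler_wpM2r ?sqr_ge0//.
  by lra.
have [F F0 AF] := mulmx_bounded A.
have F1 : 0 < F + 1 by rewrite ltr_wpDl.
move=> N; have N0 : 0 < N.+1%:R^-1 :> R by rewrite invr_gt0 ltr0n.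
have [q hq] := range_approx (divr_gt0 N0 F1) Wv0; exists q => q'.
set v := W *m map_mx ratr q in hq *.
have up := v0P _ (ex_intro2 _ _ (map_mx ratr q') I erefl : mxrange W (W *m map_mx ratr q')).
rewrite -/u in up; rewrite ler_pdivlMr// in hq.
have hv := enorm_ge0 (v0 - v).
have uv : xi - v = u + (v0 - v) by rewrite addrA subrK.
have h1 := ler_enormD u (v0 - v); rewrite -uv in h1.
have h2 := ler_enormD (A *m u) (A *m (v0 - v)); rewrite -mulmxDr -uv in h2.
have h3 := AF (v0 - v).
have h4 : 0 <= F * enorm (v0 - v) by rewrite mulr_ge0.
move: hq up; move: (N.+1%:R^-1) (enorm (xi - W *m _)) => a b hq up.
by split; lra.
Qed.

End deterministic.

(** * Measurability and the failure probability *)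

Section measurable_matrices.
Context {d : measure_display} {S : measurableType d} {R : realType}.

Definition mx_measurable (a b : nat) (M : S -> 'M[R]_(a, b)) : Prop :=
  forall i j, measurable_fun setT (fun z => M z i j).

Lemma mx_measurable_cst a b (C : 'M[R]_(a, b)) : mx_measurable (fun=> C).
Proof. by move=> i j; exact: measurable_cst. Qed.

Lemma mx_measurableM a b c (M : S -> 'M[R]_(a, b)) (N : S -> 'M[R]_(b, c)) :
  mx_measurable M -> mx_measurable N -> mx_measurable (fun z => M z *m N z).
Proof.
move=> mM mN i j; under eq_fun do rewrite mxE.
by apply: measurable_sum => l; exact: measurable_funM.
Qed.

Lemma mx_measurableB a b (M N : S -> 'M[R]_(a, b)) :
  mx_measurable M -> mx_measurable N -> mx_measurable (fun z => M z - N z).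
Proof.
move=> mM mN i j; under eq_fun do rewrite !mxE.
exact: measurable_funB.
Qed.

Lemma measurable_enorm a (M : S -> 'cV[R]_a) :
  mx_measurable M -> measurable_fun setT (fun z => enorm (M z)).
Proof.
move=> mM; rewrite /enorm.
have msqrt : measurable_fun setT (@Num.sqrt R).
  by apply: continuous_measurable_fun; exact: sqrt_continuous.
apply: (measurableT_comp msqrt).
by apply: measurable_sum => i; exact: measurable_funX.
Qed.

Lemma measurable_set_le (f g : S -> R) :
  measurable_fun setT f -> measurable_fun setT g ->
  measurable [set z | f z <= g z].
Proof.
move=> mf mg; rewrite (_ : [set z | _] = [set z | 0 <= g z - f z]).
  by apply: measurable_ge_set; exact: measurable_funB.
by apply/seteqP; split=> z /=; rewrite subr_ge0.
Qed.

Lemma measurable_forall (U : countType) (F : U -> set S) :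
  (forall q, measurable (F q)) -> measurable [set z | forall q, F q z].
Proof.
move=> mF; rewrite (_ : [set z | _] = ~` \bigcup_q ~` F q).
  apply/measurableC/countable_bigcupT_measurable => //.
  by move=> q; exact: measurableC.
apply/seteqP; split=> [z Fz [q _ /(_ (Fz q))]//|z nFz q].
by apply: contrapT => Fq; apply: nFz; exists q.
Qed.

Lemma measurable_exists (U : countType) (F : U -> set S) :
  (forall q, measurable (F q)) -> measurable [set z | exists q, F q z].
Proof.
move=> mF; rewrite (_ : [set z | _] = \bigcup_q F q).
  exact: countable_bigcupT_measurable.
by apply/seteqP; split=> [z [q Fq]|z [q _ Fq]]; exists q.
Qed.

Lemma measurable_rip_ratr (m p k : nat) (A : S -> 'M[R]_(m, p))
    (W : S -> 'M[R]_(p, k)) (eps : R) :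
  mx_measurable A -> mx_measurable W ->
  measurable [set z | rip_ratr (A z) (W z) eps].
Proof.
move=> mA mW; apply: measurable_forall => q; apply: measurable_set_le.
  apply: measurable_funM => //; apply: measurable_enorm.
  by apply: mx_measurableM => //; exact: mx_measurable_cst.
apply: measurable_enorm; apply: mx_measurableM => //.
by apply: mx_measurableM => //; exact: mx_measurable_cst.
Qed.

Lemma measurable_near_proj_ratr (m p k : nat) (A : S -> 'M[R]_(m, p))
    (W : S -> 'M[R]_(p, k)) (xi : 'cV[R]_p) :
  mx_measurable A -> mx_measurable W ->
  measurable [set z | near_proj_ratr (A z) (W z) xi].
Proof.
move=> mA mW.
have mres (q : 'cV[rat]_k) : mx_measurable (fun z => xi - W z *m map_mx ratr q).
  apply: mx_measurableB; first exact: mx_measurable_cst.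
  by apply: mx_measurableM => //; exact: mx_measurable_cst.
apply: measurable_forall => N; apply: measurable_exists => q.
apply: measurable_forall => q'; apply: measurableI; apply: measurable_set_le.
- exact: measurable_enorm.
- by apply: measurable_funD => //; exact: measurable_enorm.
- by apply: measurable_enorm; exact: mx_measurableM.
- apply: measurable_funD => //; apply: measurable_funM => //.
  exact: measurable_enorm.
Qed.

End measurable_matrices.

Lemma measure_union_le {d} {T : measurableType d} {R : realType}
    (P : {measure set T -> \bar R}) (U : eqType) (s : seq U) (B : U -> set T) (c : R) :
  (forall v, measurable (B v)) -> (forall v, v \in s -> P (B v) <= c%:E)%E ->
  (P (\big[setU/set0]_(v <- s) B v) <= ((size s)%:R * c)%:E)%E.
Proof.
move=> mB; elim: s => [|v s ih] Bc; first by rewrite big_nil measure0 mul0r.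
rewrite big_cons; apply: le_trans (measureU2 _ _ _) _ => //.
  by apply: bigsetU_measurable.
rewrite /= -add1n natrD mulrDl mul1r EFinD; apply: leeD.
  by apply: Bc; rewrite inE eqxx.
by apply: ih => a sa; apply: Bc; rewrite inE sa orbT.
Qed.

(** * Failure probability for a fixed range *)

Section assembly.
Context {d : measure_display} {T : measurableType d} {R : realType}.
Variables (P : probability T R) (e : ensemble) (m n : nat).
Variable A : 'M[{RV P >-> R}]_(m, n).
Hypotheses (m0 : (0 < m)%N) (hA : random_subgaussian e A).

Lemma gamma_rate_bounds (t : R) : 0 < t <= 1 / 2 ->
  0 < gamma_rate e t <= t ^+ 2 / 4 - t ^+ 3 / 6.
Proof.
move=> /andP[t0 t1]; have t2 : 0 < t ^+ 2 by rewrite exprn_gt0.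
have t3 : t ^+ 3 <= t ^+ 2 / 2 by rewrite exprSr; nra.
by rewrite /gamma_rate; case: e; apply/andP; split; lra.
Qed.

Lemma test_vectors_failure (s : seq 'cV[R]_n) (eps : R) : 0 < eps < 1 ->
  (forall v, v \in s -> sqnorm v = 1) ->
  exists B : set T, [/\ measurable B,
    (P B <= ((size s)%:R * (2 * expR (- (m%:R * gamma_rate e (eps / 2)))))%:E)%E &
    forall w, ~ B w -> forall v, v \in s ->
      1 - eps / 2 <= sqnorm (rmx_at A w *m v) <= 1 + eps / 2].
Proof.
move=> /andP[e0 e1] s1.
have t01 : 0 < eps / 2 <= 1 / 2 by apply/andP; split; lra.
have t01' : 0 <= eps / 2 <= 1 / 2 by apply/andP; split; lra.
have /andP[_ g1] := gamma_rate_bounds t01.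
pose L v := [set w | sqnorm (rmx_at A w *m v) <= 1 - eps / 2].
pose U v := [set w | 1 + eps / 2 <= sqnorm (rmx_at A w *m v)].
have mL v : measurable (L v) by apply: measurable_le_set; exact: measurable_fun_sqnorm.
have mU v : measurable (U v) by apply: measurable_ge_set; exact: measurable_fun_sqnorm.
exists (\big[setU/set0]_(v <- s) (L v `|` U v)); split.
- by apply: bigsetU_measurable => v _; exact: measurableU.
- apply: measure_union_le => [v|v vs]; first exact: measurableU.
  have ler : expR (- (m%:R * ((eps / 2) ^+ 2 / 4 - (eps / 2) ^+ 3 / 6))) <=
      expR (- (m%:R * gamma_rate e (eps / 2))).
    by rewrite ler_expR lerN2 ler_wpM2l.
  rewrite mulr_natl mulr2n EFinD; apply: le_trans (measureU2 _ _ _) _ => //.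
  apply: leeD.
  + by apply: le_trans (lower_tail m0 hA (s1 v vs) t01') _; rewrite lee_fin.
  + by apply: le_trans (upper_tail m0 hA (s1 v vs) t01') _; rewrite lee_fin.
- move=> w nB v vs; rewrite -bigcup_seq in nB.
  apply/andP; split; rewrite leNgt; apply/negP => h; apply: nB.
  + by exists v => //; left; exact: ltW.
  + by exists v => //; right; exact: ltW.
Qed.

(** The [4] under the logarithm is the product of two factors [2]: one for the residual added to the
    net, one for the two tails. *)
Lemma sample_size_failure (r : nat) (eps beta : R) : 0 < eps < 1 -> 0 < beta ->
  (ln (4 / beta) + r%:R * ln (12 / eps)) / gamma_rate e (eps / 2) <= m%:R ->
  2 * (12 / eps) ^+ r * (2 * expR (- (m%:R * gamma_rate e (eps / 2)))) <= beta.
Proof.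
move=> /andP[e0 e1] b0.
have t01 : 0 < eps / 2 <= 1 / 2 by apply/andP; split; lra.
have /andP[g0 _] := gamma_rate_bounds t01.
move=> h; rewrite ler_pdivrMr// -lerN2 -ler_expR opprD expRD in h.
have hb : expR (- ln (4 / beta)) = beta / 4.
  by rewrite expRN lnK ?invf_div// posrE divr_gt0.
have he : expR (- (r%:R * ln (12 / eps))) = ((12 / eps) ^+ r)^-1.
  by rewrite expRN expRM_natl lnK// posrE divr_gt0.
rewrite hb he in h; have N0 : 0 < (12 / eps) ^+ r by rewrite exprn_gt0// divr_gt0.
set N := (12 / eps) ^+ r in h N0 *; set E := expR _ in h *.
apply: (@le_trans _ _ (2 * N * (2 * (beta / 4 / N)))).
  by rewrite ler_wpM2l ?ler_wpM2l// mulr_ge0// ltW.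
by rewrite le_eqVlt; apply/orP; left; apply/eqP; field; rewrite gt_eqF.
Qed.

Definition recovers (k : nat) (B : 'M[R]_(m, n)) (V : 'M[R]_(n, k)) (eps : R)
    (xi : 'cV[R]_n) : Prop :=
  rip_ratr B V eps /\ near_proj_ratr B V xi.

Lemma measurable_recovers {d'} {S : measurableType d'} (k : nat)
    (B : S -> 'M[R]_(m, n)) (V : S -> 'M[R]_(n, k)) (eps : R) (xi : 'cV[R]_n) :
  mx_measurable B -> mx_measurable V ->
  measurable [set z | recovers (B z) (V z) eps xi].
Proof.
move=> mB mV; apply: measurableI.
  exact: measurable_rip_ratr.
exact: measurable_near_proj_ratr.
Qed.

Let mA : mx_measurable (rmx_at A).
Proof. by move=> i j; under eq_fun do rewrite mxE; exact: measurable_funP. Qed.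

Lemma fixed_range_failure (k : nat) (V : 'M[R]_(n, k)) (eps beta : R)
    (xi : 'cV[R]_n) : 0 < eps < 1 -> 0 < beta ->
  (ln (4 / beta) + (\rank V)%:R * ln (12 / eps)) / gamma_rate e (eps / 2) <= m%:R ->
  (P (~` [set w | recovers (rmx_at A w) V eps xi]) <= beta%:E)%E.
Proof.
move=> eps01 b0 hm; have [s [sN s1 sP]] := test_vectors V xi eps01.
have [B [mB PB nB]] := test_vectors_failure eps01 s1.
have mG : measurable [set w | recovers (rmx_at A w) V eps xi].
  by apply: measurable_recovers => //; exact: mx_measurable_cst.
apply: (@le_trans _ _ (P B)).
  apply: le_measure; rewrite ?inE//; first exact: measurableC.
  move=> w nG; apply: contrapT => Bw; apply: nG.
  by apply: sP => v vs; exact: nB.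
apply: le_trans PB _; rewrite lee_fin.
apply: le_trans (sample_size_failure eps01 b0 hm).
by rewrite ler_wpM2r// mulr_ge0// expR_ge0.
Qed.

End assembly.

(** * Integration over the law of the random range *)

Section random_range.
Context {d : measure_display} {T : measurableType d} {R : realType}.
Variables (P : probability T R).

(** The generating family inside [rmx_sigma], so that [independent_rmx] is by conversion the
    independence of two generated sigma-algebras. *)
Definition rmx_generators (p k : nat) (A : 'M[{RV P >-> R}]_(p, k)) : set (set T) :=
  [set E | exists i j, preimage_set_system setT (A i j) measurable E].

Lemma rmx_generators_measurable p k (A : 'M[{RV P >-> R}]_(p, k)) :
  rmx_generators A `<=` measurable.
Proof. by move=> _ [i [j [B mB <-]]]; exact: measurable_funP. Qed.

Lemma measurable_rmx_at p k (A : 'M[{RV P >-> R}]_(p, k)) :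
  mx_measurable (rmx_at A : g_sigma_algebraType (rmx_generators A) -> _).
Proof.
move=> i j; under eq_fun do rewrite mxE.
by move=> _ B mB; apply: sub_sigma_algebra; exists i, j, B.
Qed.

Lemma random_range_failure (e : ensemble) (m n k : nat)
    (A : 'M[{RV P >-> R}]_(m, n)) (W : 'M[{RV P >-> R}]_(n, k))
    (eps beta : R) (xi : 'cV[R]_n) :
  (0 < m)%N -> random_subgaussian e A -> independent_rmx A W ->
  0 < eps < 1 -> 0 < beta ->
  {ae P, forall w, (ln (4 / beta) + (\rank (rmx_at W w))%:R * ln (12 / eps))
     / gamma_rate e (eps / 2) <= m%:R} ->
  exists2 E : set T, measurable E /\ (P (~` E) <= beta%:E)%E &
    forall w, E w -> recovers (rmx_at A w) (rmx_at W w) eps xi.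
Proof.
move=> m0 hA ind eps01 b0 hm.
pose G1 := rmx_generators A; pose G2 := rmx_generators W.
have mG1 := @rmx_generators_measurable _ _ A.
have mG2 := @rmx_generators_measurable _ _ W.
have mA : mx_measurable (rmx_at A).
  by move=> i j; under eq_fun do rewrite mxE; exact: measurable_funP.
have mW : mx_measurable (rmx_at W).
  by move=> i j; under eq_fun do rewrite mxE; exact: measurable_funP.
pose S := [set z : g_sigma_algebraType G1 * g_sigma_algebraType G2 |
  recovers (rmx_at A (z.1 : T)) (rmx_at W (z.2 : T)) eps xi].
have mS : measurable S.
  apply: measurable_recovers => i j.
    exact: (measurableT_comp (@measurable_rmx_at _ _ A i j) measurable_fst).
  exact: (measurableT_comp (@measurable_rmx_at _ _ W i j) measurable_snd).
pose E := [set w | recovers (rmx_at A w) (rmx_at W w) eps xi].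
have mE : measurable E by exact: measurable_recovers.
exists E => //; split => //.
pose f (z : g_sigma_algebraType G1 * g_sigma_algebraType G2) : \bar R :=
  (\1_(~` S) z)%:E.
have mf : measurable_fun setT f.
  by apply/measurable_EFinP/measurable_indic; exact: measurableC.
have f0 z : (0 <= f z)%E by rewrite lee_fin.
have intf w2 : (\int[P]_w1 f (sub_id G1 w1, sub_id G2 w2) =
    P (~` [set w1 | recovers (rmx_at A w1) (rmx_at W w2) eps xi]))%E.
  have mV : measurable (~` [set w1 | recovers (rmx_at A w1) (rmx_at W w2) eps xi]).
    by apply/measurableC/measurable_recovers => //; exact: mx_measurable_cst.
  by rewrite -[in RHS](setIT (~` _)) -integral_indic.
have PE : (P (~` E) = \int[P]_w f (sub_id G1 w, sub_id G2 w))%E.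
  by rewrite -[in LHS](setIT (~` E)) -integral_indic//; exact: measurableC.
rewrite PE (indep_fubini mG1 mG2 ind mf f0).
have -> : beta%:E = (\int[P]_w (cst beta%:E w))%E.
  transitivity (beta%:E * 1)%E; first by rewrite mule1.
  rewrite integral_cst//; congr (_ * _)%E; apply/esym; exact: probability_setT.
apply: ae_ge0_le_integral => //.
- by move=> w _; exact: integral_ge0.
- exact: (measurable_integral_section P mG1 mG2 mf f0).
- by move=> w _; rewrite lee_fin ltW.
(* Here [W] is frozen at its value at [w]; the sample size suits the rank of that value for almost
   every [w]. *)
- apply: filterS hm => w hw _; rewrite intf.
  exact: (fixed_range_failure m0 hA).
Qed.

End random_range.

Unset Implicit Arguments.

Theorem theorem2p6 (R : realType) (d : measure_display) (T : measurableType d)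
    (P : probability T R) (m n : nat) (e : ensemble)
    (A : 'M[{RV P >-> R}]_(m, n)) (W : 'M[{RV P >-> R}]_n)
    (xi : 'cV[R]_n) (eta : 'cV[R]_m) (delta epsilon beta : R)
    (hm : (0 < m)%N) (hn : (0 < n)%N)
    (hA : random_subgaussian e A)
    (hWsym : {ae P, forall w, (rmx_at W w)^T = rmx_at W w})
    (hWeig : {ae P, forall w,
       forall a, eigenvalue (rmx_at W w) a -> 0 <= a <= 1})
    (hAW : independent_rmx A W)
    (hdelta : 0 <= delta)
    (heps : 0 < epsilon < 1) (hbeta : 0 < beta < 1)
    (hmr : {ae P, forall w,
       (ln (4 / beta) + (\rank (rmx_at W w))%:R * ln (12 / epsilon))
         / gamma_rate e (epsilon / 2) <= m%:R}) :
  exists E : set T,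
    [/\ measurable E,
        ((1 - beta)%:E <= P E)%E &
        forall w, E w ->
          let Aw := rmx_at A w in
          let Ww := rmx_at W w in
          let b := Aw *m xi + eta in
          feasible Aw Ww b delta !=set0 ->
          forall x, minimizer Aw Ww b delta x ->
            enorm (x - xi) <=
              (1 + 2 / (1 - epsilon)) * dist_to xi (mxrange Ww)
              + (delta + enorm eta) / (1 - epsilon)].
Proof.
have /andP[b0 _] := hbeta.
have [E [mE PE] Erec] := random_range_failure xi hm hA hAW heps b0 hmr.
exists E; split => //.
- have PCE : (P (~` E) = 1 - P E)%E by exact: probability_setC.
  move: PE; rewrite PCE -(fineK (fin_num_measure P E mE)) -EFinB !lee_fin.
  by rewrite !lerBlDr [beta + _]addrC.
- move=> w /Erec[rip near] Aw Ww b _ x [fx _].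
  exact: (recovery_bound heps hdelta rip near).
Qed.
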